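(* Let $\mathcal{A}$ be a finite alphabet and let $\mathbf{p},\mathbf{q}$ be irreducible pairs on $\mathcal{A}$ which are piece-wise order reversing and have the same Type. If $\mathcal{P}(\mathbf{p})=\mathcal{P}(\mathbf{q})$ and $\mathcal{M}(\mathbf{p})=\mathcal{M}(\mathbf{q})$, then the non-labeled Rauzy classes of $\mathbf{p}$ and $\mathbf{q}$ coincide.
   Context: Let $n=\#\mathcal{A}\ge 2$. A pair is $\mathbf{p}=(p_0,p_1)$ with $p_0,p_1:\mathcal{A}\to\{1,\dots,n\}$ bijections (row $\varepsilon$ lists $p_\varepsilon^{-1}(1),\dots,p_\varepsilon^{-1}(n)$). Irreducible: $p_0^{-1}\{1,\dots,k\}\ne p_1^{-1}\{1,\dots,k\}$ for $1\le k<n$. Rauzy move of type $\varepsilon$: $\varepsilon\mathbf{p}=(p'_0,p'_1)$, $p'_\varepsilon=p_\varepsilon$, and for $z=p_\varepsilon^{-1}(n)$, $p'_{1-\varepsilon}(b)=p_{1-\varepsilon}(b)$ if $p_{1-\varepsilon}(b)\le p_{1-\varepsilon}(z)$, $=p_{1-\varepsilon}(b)+1$ if $p_{1-\varepsilon}(z)<p_{1-\varepsilon}(b)<n$, $=p_{1-\varepsilon}(z)+1$ if $p_{1-\varepsilon}(b)=n$. The labeled Rauzy class of $\mathbf{p}$ is the set of pairs reachable from $\mathbf{p}$ by Rauzy moves; the non-labeled Rauzy class is its image under $(p_0,p_1)\mapsto p_1\circ p_0^{-1}\in\mathfrak{S}_n$. Invariants: define $\mathcal{S}(\mathbf{p}):\mathcal{A}\to\mathcal{A}$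 by $\mathcal{S}(\mathbf{p})(\alpha)=p_0^{-1}(1)$ if $p_1(\alpha)=1$; $=p_0^{-1}(p_0(p_1^{-1}(n))+1)$ if $p_1(\alpha)=p_1(p_0^{-1}(n))+1$; $=p_0^{-1}(p_0(p_1^{-1}(p_1(\alpha)-1))+1)$ otherwise. $\mathcal{M}(\mathbf{p})$ is the length of the cycle of the permutation $\mathcal{S}(\mathbf{p})$ containing $p_0^{-1}(1)$. Let $\mathcal{Y}(\mathbf{p})$ be the first return map of $\mathcal{S}(\mathbf{p})$ to $\mathcal{A}\setminus\{p_0^{-1}(1)\}$ (i.e. $\mathcal{Y}(\mathbf{p})(b)=\mathcal{S}(\mathbf{p})^2(b)$ if $p_1(b)=1$, $\mathcal{S}(\mathbf{p})(b)$ otherwise), and $\mathcal{P}(\mathbf{p})$ the unordered list (with multiplicity) of cycle lengths of $\mathcal{Y}(\mathbf{p})$. Standard: $p_0^{-1}(1)=p_1^{-1}(n)$, $p_1^{-1}(1)=p_0^{-1}(n)$. A standard pair is piece-wise order reversing if there are $2=k_0<\dots<k_\ell=n$ with $B_i=p_0^{-1}\{k_{i-1},\dots,k_i-1\}=p_1^{-1}\{k_{i-1},\dots,k_i-1\}$ and $p_0(b)+p_1(b)=k_{i-1}+k_i-1$ for $b\in B_i$; the $B_i$ are blocks, a block of $k$ letters is a $k$-block. Chains: with the $1$-blocks $S_1,\dots,S_{k-1}$ listed left to right, chain $C_i$ is the possibly empty sequence of consecutive blocks strictly between $S_{i-1}$ and $S_i$ ($C_1$ before $S_1$, $C_k$ after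 $S_{k-1}$). Types: $\langle1\rangle$: at most one nonempty chain, consisting (if present) of exactly one block. Types $\langle2\rangle$–$\langle5\rangle$ require more than one block of size $\ge2$, and: $\langle2\rangle$: all nonempty chains consist of $2$-blocks; $\langle3\rangle$: each nonempty chain is (i) $m$ $2$-blocks, a $3$-block, $\ell$ $2$-blocks ($m,\ell\ge0$) or (ii) $m\ge1$ $2$-blocks, with at least one chain of form (i); $\langle4\rangle$: exactly one chain is a $4$-block followed by $m\ge0$ $2$-blocks, all other nonempty chains consist of $2$-blocks; $\langle5\rangle$: exactly one chain is a single $5$-block, every other nonempty chain is exactly one $2$-block. *)

(* Defs.v *)
From mathcomp Require Import all_boot.
Set Implicit Arguments. Unset Strict Implicit. Unset Printing Implicit Defensive.

Section Pairs.
Variable A : finType.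

(* A pair p = (p_0, p_1); positions are 1..n with n = #|A|. *)
Definition pair := ((A -> nat) * (A -> nat))%type.

Definition row (p : pair) (e : bool) : A -> nat := if e then p.2 else p.1.

Definition bij_pos (f : A -> nat) : Prop :=
  injective f /\ (forall a, 1 <= f a <= #|A|) /\
  (forall k, 1 <= k <= #|A| -> exists a, f a = k).

Definition is_pair (p : pair) : Prop := bij_pos p.1 /\ bij_pos p.2.

Definition pinv (f : A -> nat) (k : nat) : option A := [pick a | f a == k].
Definition pinvd (d : A) (f : A -> nat) (k : nat) : A := odflt d (pinv f k).

Definition irreducible (p : pair) : Prop :=
  forall k, 1 <= k < #|A| -> [set a | p.1 a <= k] != [set a | p.2 a <= k].

Definition rauzy (e : bool) (p : pair) : pair :=
  let f := row p e in let g := row p (~~ e) in let n := #|A| in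
  match pinv f n with
  | None => p
  | Some z =>
    let g' := fun b => if g b <= g z then g b
                       else if g b < n then (g b).+1 else (g z).+1 in
    if e then (g', f) else (f, g')
  end.

Inductive reach (p : pair) : pair -> Prop :=
  | reach_refl : reach p p
  | reach_step q e : reach p q -> reach p (rauzy e q).

Definition perm_word (p : pair) : seq nat :=
  [seq odflt 0 (omap p.2 (pinv p.1 k)) | k <- iota 1 #|A|].

Definition nl_class (p : pair) (s : seq nat) : Prop :=
  exists q, reach p q /\ perm_word q = s.

(* the map S(p) (the defaults are irrelevant for irreducible pairs) *)
Definition calS (p : pair) (al : A) : A :=
  let n := #|A| in
  if p.2 al == 1 then pinvd al p.1 1
  else if p.2 al == (p.2 (pinvd al p.1 n)).+1 then
    pinvd al p.1 (p.1 (pinvd al p.2 n)).+1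
  else pinvd al p.1 (p.1 (pinvd al p.2 (p.2 al).-1)).+1.

Definition calM (p : pair) : nat :=
  match pinv p.1 1 with Some a0 => order (calS p) a0 | None => 0 end.

(* Y(p): first return map of S(p) to A \ {p_0^{-1}(1)} *)
Definition calY (p : pair) (b : A) : A :=
  if p.2 b == 1 then calS p (calS p b) else calS p b.

(* P(p): list of cycle lengths of Y(p) on A \ {p_0^{-1}(1)}, one entry per
   cycle (each cycle is represented by its canonical root [froot]);
   compared up to permutation (i.e. as a multiset). *)
Definition calP (p : pair) : seq nat :=
  match pinv p.1 1 with
  | Some a0 => [seq order (calY p) x | x <- enum A &
                  (x != a0) && (froot (calY p) x == x)]
  | None => [::]
  end.

Definition standard (p : pair) : Prop :=
  pinv p.1 1 = pinv p.2 #|A| /\ pinv p.2 1 = pinv p.1 #|A|.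

Definition por_with (ks : seq nat) (p : pair) : Prop :=
  standard p /\ [/\ ks != [::], head 0 ks = 2, last 0 ks = #|A|,
      sorted ltn ks &
      forall i, i.+1 < size ks ->
        let lo := nth 0 ks i in let hi := nth 0 ks i.+1 in
        [set b | lo <= p.1 b < hi] = [set b | lo <= p.2 b < hi] /\
        (forall b, lo <= p.1 b < hi -> p.1 b + p.2 b = lo + hi - 1)].

Definition por (p : pair) : Prop := exists ks, por_with ks p.

End Pairs.

Definition block_sizes (ks : seq nat) : seq nat :=
  [seq nth 0 ks i.+1 - nth 0 ks i | i <- iota 0 (size ks).-1].

(* chains C_1, ..., C_k: maximal runs of blocks between 1-blocks
   (given as lists of block sizes) *)
Fixpoint chains (s : seq nat) : seq (seq nat) :=
  match s with
  | [::] => [:: [::]]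
  | x :: s' => let c := chains s' in
               if x == 1 then [::] :: c else (x :: head [::] c) :: behead c
  end.

Definition many_big (sz : seq nat) : Prop := 1 < count (fun x => 2 <= x) sz.

Definition chain_i (c : seq nat) : Prop :=
  exists m l, c = nseq m 2 ++ 3 :: nseq l 2.
Definition chain_ii (c : seq nat) : Prop :=
  exists m, 1 <= m /\ c = nseq m 2.

Definition type1 (sz : seq nat) : Prop :=
  let cs := chains sz in
  count (fun c => c != [::]) cs <= 1 /\
  (forall c, c \in cs -> c != [::] -> size c = 1).

Definition type2 (sz : seq nat) : Prop :=
  many_big sz /\ forall c, c \in chains sz -> all (fun x => x == 2) c.

Definition type3 (sz : seq nat) : Prop :=
  let cs := chains sz in
  [/\ many_big sz,
      (forall c, c \in cs -> c != [::] -> chain_i c \/ chain_ii c) &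
      exists2 c, c \in cs & chain_i c].

Definition type4 (sz : seq nat) : Prop :=
  let cs := chains sz in
  many_big sz /\
  exists2 i, i < size cs &
    (exists m, nth [::] cs i = 4 :: nseq m 2) /\
    (forall j, j < size cs -> j != i -> all (fun x => x == 2) (nth [::] cs j)).

Definition type5 (sz : seq nat) : Prop :=
  let cs := chains sz in
  many_big sz /\
  exists2 i, i < size cs &
    nth [::] cs i = [:: 5] /\
    (forall j, j < size cs -> j != i ->
       nth [::] cs j = [::] \/ nth [::] cs j = [:: 2]).

Definition type_n (t : nat) (sz : seq nat) : Prop :=
  match t with
  | 1 => type1 sz | 2 => type2 sz | 3 => type3 sz | 4 => type4 sz
  | 5 => type5 sz | _ => False
  end.

Definition has_type (A : finType) (t : nat) (p : pair A) : Prop :=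
  exists ks, por_with ks p /\ type_n t (block_sizes ks).

Definition same_type (A : finType) (p q : pair A) : Prop :=
  exists t, [/\ 1 <= t <= 5, has_type t p & has_type t q].

(* Main.v *)
Require Import Defs.
From mathcomp Require Import all_boot.
From mathcomp Require Import zify.
(** Label a standard pair by its two rows, [a W z] over [z V a].  Four runs of
    Rauzy moves realize an inner switch: if the letters [x], [y] occur in this
    order in both rows, the prefix ending at [x] and the factor ending at [y]
    are exchanged in both rows simultaneously.  For a piece-wise order reversing
    pair, [V] is obtained from [W] by reversing consecutive blocks, so the pair
    is encoded by the list of its block sizes.  Inner switches permute all
    chains but the last, reverse such a chain, and transfer blocks between
    chains: [4 U 2 2] becomes [2 2 U 4], [5 U 1 2] becomes [2 U 1 5], and
    [P 3 2^l 1 X 3] becomes [X 3 2^l 1 P 3].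

    Each chain, with the 1-block closing it (the letter [z] for the last chain),
    is invariant under [calY], and its cycle lengths are read off the sizes:
    [2^m] gives [2m+1]; [2^m 3 2^l] gives [2m+2] and [2l+2]; [4 2^m] gives
    [2m+5]; [5] gives [3] and [3].  The cycle of [z] has length [calM - 1].
    Hence two lists of the same type with equal invariants differ by the moves
    above. *)

Set Implicit Arguments. Unset Strict Implicit. Unset Printing Implicit Defensive.

(** * Inner switches *)

(* Rows are written without their end letters [a] and [z]. *)
Inductive sw (T : Type) : seq T -> seq T -> seq T -> seq T -> Prop :=
| sw_refl W V : sw W V W V
| sw_trans W V W' V' W'' V'' : sw W V W' V' -> sw W' V' W'' V'' -> sw W V W'' V''
| sw_swap P1 P2 x Q1 Q2 y R1 R2 :
    sw (P1 ++ x :: Q1 ++ y :: R1) (P2 ++ x :: Q2 ++ y :: R2)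
       (Q1 ++ y :: P1 ++ x :: R1) (Q2 ++ y :: P2 ++ x :: R2).

Lemma sw_sym T (W V W' V' : seq T) : sw W V W' V' -> sw W' V' W V.
Proof.
elim=> [*|? ? ? ? ? ? _ h1 _ h2|*]; [exact: sw_refl|exact: sw_trans h2 h1|exact: sw_swap].
Qed.

Lemma sw_map T U (g : T -> U) (W V W' V' : seq T) :
  sw W V W' V' -> sw (map g W) (map g V) (map g W') (map g V').
Proof.
elim=> [*|? ? ? ? ? ? _ h1 _ h2|P1 P2 x Q1 Q2 y R1 R2]; [exact: sw_refl|exact: sw_trans h1 h2|].
do 8! rewrite ?map_cat /=; exact: sw_swap.
Qed.

Lemma sw_perm (T : eqType) (W V W' V' : seq T) : sw W V W' V' -> perm_eq W W'.
Proof.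
elim=> [*|? ? ? ? ? ? _ h1 _ h2|P1 P2 x Q1 Q2 y R1 R2]; [exact: perm_refl|exact: perm_trans h1 h2|].
by apply/permP=> a; do 3! rewrite ?count_cat /=; lia.
Qed.

(** * Block reversal and moves on block sizes *)

Fixpoint brev (T : Type) (sz : seq nat) (W : seq T) : seq T :=
  if sz is k :: sz' then rev (take k W) ++ brev sz' (drop k W) else [::].

Lemma brev_cat T s1 s2 (W1 W2 : seq T) : size W1 = sumn s1 ->
  brev (s1 ++ s2) (W1 ++ W2) = brev s1 W1 ++ brev s2 W2.
Proof.
elim: s1 W1 => [|k s IH] W1 /=; first by move/size0nil=> ->.
move=> sW; rewrite take_cat drop_cat; case: ltnP => h.
  by rewrite IH ?catA // size_drop sW addKn.
(* The first block uses up [W1]: comparing sizes leaves [k = size W1], and the sizes still in [s]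
   sum to 0. *)
have e : k = size W1 by lia.
have s0 : sumn s = 0 by lia.
by rewrite -e subnn take0 drop0 cats0 take_oversize ?drop_oversize -?e // -catA -IH.
Qed.

Lemma map_brev T U (g : T -> U) sz W : map g (brev sz W) = brev sz (map g W).
Proof. by elim: sz W => [|k s IH] W //=; rewrite map_cat map_rev map_take IH map_drop. Qed.

Lemma split_size T m n (W : seq T) : size W = m + n ->
  exists W1 W2, [/\ W = W1 ++ W2, size W1 = m & size W2 = n].
Proof.
move=> sW; exists (take m W), (drop m W).
by rewrite cat_take_drop size_drop size_takel sW ?leq_addr // addKn.
Qed.

(* Block sizes [s] lead to [s'] by inner switches, up to renaming letters. *)
Definition beq (s s' : seq nat) : Prop :=
  sumn s = sumn s' /\ forall (T : Type) (W : seq T), size W = sumn s ->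
    exists W', size W' = sumn s' /\ sw W (brev s W) W' (brev s' W').

Lemma beq_refl s : beq s s.
Proof. by split=> // T W sW; exists W; split=> //; exact: sw_refl. Qed.

Lemma beq_trans s1 s2 s3 : beq s1 s2 -> beq s2 s3 -> beq s1 s3.
Proof.
move=> [e1 h1] [e2 h2]; split; first by rewrite e1.
move=> T W /h1 [W' [s' w']]; have [W'' [s'' w'']] := h2 _ _ s'.
by exists W''; split=> //; exact: sw_trans w' w''.
Qed.

(** The definition starts from [W], symmetry from [W']. On the word of distinct numbers [0, 1, ...]
    the hypothesis shows the move as a permutation of letters; renaming its result [V] to [W'] and
    running the switches backwards gives the word. This uses that [beq] quantifies over all letter
    types. *)
Lemma beq_sym s1 s2 : beq s1 s2 -> beq s2 s1.
Proof.
move=> [e h]; split=> // T [|d W'] sW'.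
  (* The empty word is treated apart, since [g] below needs a default letter. *)
  exists [::]; split; first by rewrite e -sW'.
  have [W [sW]] := h T [::] (etrans sW' (esym e)).
  by rewrite -sW' in sW; rewrite (size0nil sW); apply: sw_sym.
have [V [sV hV]] := h nat (iota 0 (sumn s1)) (size_iota _ _).
have uV : uniq V by rewrite -(perm_uniq (sw_perm hV)) iota_uniq.
pose g i := nth d (d :: W') (index i V).
have gV : map g V = d :: W'.
  apply: (@eq_from_nth _ d); rewrite size_map ?sV // => i ib.
  by rewrite (nth_map 0) ?sV // /g index_uniq ?sV.
exists (map g (iota 0 (sumn s1))); rewrite size_map size_iota; split=> //.
by have := sw_sym (sw_map g hV); rewrite !map_brev gV.
Qed.

Ltac swp P1 P2 x Q1 Q2 y R1 R2 :=
  eapply sw_trans; [have := sw_swap P1 P2 x Q1 Q2 y R1 R2; rewrite /= -?catA /= -?catA /= -?catA /=; let h := fresh in move=> h; exact h|].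

(** Reversal acts within the blocks of [A], [B], [R], so the letters [x], [y] of the two 1-blocks
    keep their order in both rows, and one switch at them suffices. *)
Lemma beq_swap A B R : beq (A ++ 1 :: B ++ 1 :: R) (B ++ 1 :: A ++ 1 :: R).
Proof.
split; first by do 3! rewrite ?sumn_cat /=; lia.
move=> T W; rewrite sumn_cat /= sumn_cat /= !add1n => /split_size [WA [W1 [-> sA]]].
case: W1 => // x W1 [] /split_size [WB [W2 [-> sB]]].
case: W2 => // y W2 [] sR.
exists (WB ++ y :: WA ++ x :: W2); do 3! rewrite ?size_cat ?sumn_cat /=.
split; first by lia.
by do 4! rewrite ?brev_cat //= ?take0 ?drop0; exact: sw_swap.
Qed.

(* The switch sequences from here to [sw3_shift] were found by computer search;
   the capital letters stand for words that are never cut. *)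
Lemma sw4 T (a b c d e f g h : T) U U' R R' :
  sw ([:: a; b; c; d] ++ U ++ [:: e; f; g; h] ++ R)
     ([:: d; c; b; a] ++ U' ++ [:: f; e; h; g] ++ R')
     ([:: a; d; c; b] ++ U ++ [:: e; h; g; f] ++ R)
     ([:: d; a; b; c] ++ U' ++ [:: f; g; h; e] ++ R').
Proof.
rewrite /=.
swp [:: a] [:: d; c] b ([:: c; d] ++ U) ([:: a] ++ U' ++ [:: f]) e ([:: f; g; h] ++ R) ([:: h; g] ++ R').
swp (Nil T) ([:: a] ++ U' ++ [:: f; e; d]) c ([:: d] ++ U ++ [:: e; a; b; f; g]) [:: b] h R ([:: g] ++ R').
swp ([:: d] ++ U ++ [:: e]) [:: b; h] a [:: b; f] (U' ++ [:: f; e; d; c]) g ([:: h; c] ++ R) R'.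
swp [:: b] U' f ([:: g; d] ++ U ++ [:: e; a; h]) [:: e; d] c R ([:: g; b; h; a] ++ R').
swp [:: g] [:: e] d (U ++ [:: e; a]) ([:: c] ++ U' ++ [:: f; g; b]) h ([:: c; b; f] ++ R) ([:: a] ++ R').
swp (U ++ [:: e; a; h]) ([:: c] ++ U' ++ [:: f]) g [:: d; c] (Nil T) b ([:: f] ++ R) ([:: h; e; d; a] ++ R').
swp ([:: d; c; b] ++ U) ([:: b; c] ++ U' ++ [:: f; g; h]) e (Nil T) [:: d] a ([:: h; g; f] ++ R) R'.
exact: sw_refl.
Qed.

Lemma sw5 T (a b c d e f g h : T) U U' R R' :
  sw ([:: a; b; c; d; e] ++ U ++ [:: f; g; h] ++ R)
     ([:: e; d; c; b; a] ++ U' ++ [:: f; h; g] ++ R')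
     ([:: d; b] ++ U ++ [:: f; a; h; c; g; e] ++ R)
     ([:: b; d] ++ U' ++ [:: f; e; g; c; h; a] ++ R').
Proof.
rewrite /=.
swp [:: a] [:: e; d; c] b ([:: c; d; e] ++ U) ([:: a] ++ U') f ([:: g; h] ++ R) ([:: h; g] ++ R').
swp [:: c] ([:: a] ++ U' ++ [:: f; e]) d ([:: e] ++ U ++ [:: f; a; b; g]) [:: c; b] h R ([:: g] ++ R').
swp ([:: e] ++ U ++ [:: f]) [:: c; b; h] a [:: b] (U' ++ [:: f; e; d]) g ([:: h; c; d] ++ R) R'.
swp [:: b; g] (U' ++ [:: f]) e (U ++ [:: f; a; h; c]) (Nil T) d R ([:: g; c; b; h; a] ++ R').
swp (U ++ [:: f; a; h]) ([:: d] ++ U' ++ [:: f; e; g]) c [:: d] (Nil T) b ([:: g; e] ++ R) ([:: h; a] ++ R').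
exact: sw_refl.
Qed.

Lemma sw3_swap T (c d e f k l m : T) P P' U U' X X' R R' :
  sw (P ++ [:: c; d; e] ++ U ++ f :: X ++ [:: k; l; m] ++ R)
     (P' ++ [:: e; d; c] ++ U' ++ f :: X' ++ [:: m; l; k] ++ R')
     (X ++ k :: U ++ [:: f; m; d] ++ P ++ [:: c; l; e] ++ R)
     (X' ++ m :: U' ++ [:: f; k; d] ++ P' ++ [:: e; l; c] ++ R').
Proof.
rewrite /=.
swp P (P' ++ [:: e; d]) c ([:: d; e] ++ U) U' f (X ++ [:: k; l; m] ++ R) (X' ++ [:: m; l; k] ++ R').
swp (Nil T) (U' ++ [:: f] ++ P' ++ [:: e]) d ([:: e] ++ U ++ [:: f] ++ P ++ [:: c] ++ X ++ [:: k; l]) ([:: c] ++ X') m R ([:: l; k] ++ R').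
swp ([:: e] ++ U) ([:: c] ++ X' ++ [:: m] ++ U') f (P ++ [:: c] ++ X ++ [:: k]) (P' ++ [:: e; d]) l ([:: m; d] ++ R) ([:: k] ++ R').
swp (P ++ [:: c] ++ X ++ [:: k; l]) P' e (U ++ [:: f; m]) (Nil T) d R ([:: l; c] ++ X' ++ [:: m] ++ U' ++ [:: f; k] ++ R').
swp (U ++ [:: f; m; d] ++ P) ([:: d] ++ P' ++ [:: e; l]) c X (X' ++ [:: m] ++ U' ++ [:: f]) k ([:: l; e] ++ R) R'.
exact: sw_refl.
Qed.

(** Afterwards [k u m] is a reversed 3-block, and the rest, [G f d v] over [d G' f v], has the shape
    treated by [sw_close]. *)
Lemma sw3_open T (d f k m u v : T) X X' G G' R R' :
  sw (X ++ [:: k; u; v] ++ G ++ [:: f; m; d] ++ R)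
     (X' ++ [:: m; v; u] ++ G' ++ [:: f; k; d] ++ R')
     (X ++ [:: k; u; m] ++ G ++ [:: f; d; v] ++ R)
     (X' ++ [:: m; u; k; d] ++ G' ++ [:: f; v] ++ R').
Proof.
rewrite /=.
swp (X ++ [:: k]) (X' ++ [:: m; v]) u ([:: v] ++ G) G' f ([:: m; d] ++ R) ([:: k; d] ++ R').
swp (Nil T) (G' ++ [:: f] ++ X' ++ [:: m]) v (G ++ [:: f] ++ X ++ [:: k; u; m]) [:: u; k] d R R'.
swp G ([:: u; k; d] ++ G') f (X ++ [:: k; u]) X' m ([:: d; v] ++ R) ([:: v] ++ R').
exact: sw_refl.
Qed.

(** Splits off the 2-block [u d]; the rest has the shape of [sw_close] again, with [v], [w] in the
    roles of [d], [v]. *)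
Lemma sw3_shift T (d f u v w : T) Z Z' G G' R R' :
  sw (Z ++ [:: u; w] ++ G ++ [:: f; d; v] ++ R)
     (Z' ++ [:: d; w; u] ++ G' ++ [:: f; v] ++ R')
     (Z ++ [:: u; d] ++ G ++ [:: f; v; w] ++ R)
     (Z' ++ [:: d; u; v] ++ G' ++ [:: f; w] ++ R').
Proof.
rewrite /=.
swp Z (Z' ++ [:: d; w]) u ([:: w] ++ G) G' f ([:: d; v] ++ R) ([:: v] ++ R').
swp (Nil T) (G' ++ [:: f] ++ Z' ++ [:: d]) w (G ++ [:: f] ++ Z ++ [:: u; d]) [:: u] v R R'.
swp G ([:: u; v] ++ G') f (Z ++ [:: u]) Z' d ([:: v; w] ++ R) ([:: w] ++ R').
exact: sw_refl.
Qed.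
Lemma beq4 U R : beq (4 :: U ++ 2 :: 2 :: R) (2 :: 2 :: U ++ 4 :: R).
Proof.
split; first by do 3! rewrite ?sumn_cat /=; lia.
move=> T W; rewrite /= sumn_cat /= !(addSn, add0n).
case: W => [|a [|b [|c [|d W]]]] //= [] /split_size [u [W2 [-> sU]]].
case: W2 => [|e [|f [|g [|h r]]]] //= [] sR.
exists ([:: a; d; c; b] ++ u ++ [:: e; h; g; f] ++ r); split.
  by do 3! rewrite /= ?size_cat ?sumn_cat /=; lia.
rewrite /= !take0 !drop0 !brev_cat //= !take0 !drop0.
exact: sw4.
Qed.

Lemma beq5 U R : beq (5 :: U ++ 1 :: 2 :: R) (2 :: U ++ 1 :: 5 :: R).
Proof.
split; first by do 3! rewrite ?sumn_cat /=; lia.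
move=> T W; rewrite /= sumn_cat /= !(addSn, add0n).
case: W => [|a [|b [|c [|d [|e W]]]]] //= [] /split_size [u [W2 [-> sU]]].
case: W2 => [|f [|g [|h r]]] //= [] sR.
exists ([:: d; b] ++ u ++ [:: f; a; h; c; g; e] ++ r); split.
  by do 3! rewrite /= ?size_cat ?sumn_cat /=; lia.
rewrite /= !take0 !drop0 !brev_cat //= !take0 !drop0.
exact: sw5.
Qed.

(** Each use of [sw3_shift] completes one 2-block. At the end [f d v] over [d f v] is a 2-block
    followed by a 1-block. *)
Lemma sw_close T l (G Z Z' : seq T) f d v R R' : size G = l.*2 ->
  exists D, size D = l.*2 + 3 /\
    sw (Z ++ G ++ [:: f; d; v] ++ R) (Z' ++ d :: brev (nseq l 2) G ++ [:: f; v] ++ R')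
       (Z ++ D ++ R) (Z' ++ brev (nseq l.+1 2 ++ [:: 1]) D ++ R').
Proof.
elim: l G Z Z' d v => [|l IH] G Z Z' d v.
  by move/size0nil=> ->; exists [:: f; d; v]; split=> //; exact: sw_refl.
case: G => [|u [|w G]] //= sG0; have sG : size G = l.*2 by move: sG0; rewrite doubleS => -[].
have [D [sD h]] := IH G (Z ++ [:: u; d]) (Z' ++ [:: d; u]) v w sG.
exists [:: u, d & D]; split; first by rewrite /= sD; lia.
rewrite take0 drop0; apply: sw_trans (sw3_shift d f u v w Z Z' G _ R R') _.
by move: h; rewrite /= ?take0 ?drop0 -!catA.
Qed.

(** For [l = 0], [k f m d] over [m f k d] already is a 3-block and a 1-block. Otherwise [sw3_open]
    completes the 3-block with the first letter of [U], and [sw_close] restores the 2-blocks. *)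
Lemma sw_block T l (U X X' : seq T) f k m d R R' : size U = l.*2 ->
  exists D, size D = l.*2 + 4 /\
    sw (X ++ k :: U ++ [:: f; m; d] ++ R)
       (X' ++ m :: brev (nseq l 2) U ++ [:: f; k; d] ++ R')
       (X ++ D ++ R) (X' ++ brev (3 :: nseq l 2 ++ [:: 1]) D ++ R').
Proof.
case: l => [|l].
  by move/size0nil=> ->; exists [:: k; f; m; d]; split=> //; exact: sw_refl.
case: U => [|u [|v G]] //= sG0; have sG : size G = l.*2 by move: sG0; rewrite doubleS => -[].
have [D [sD h]] := sw_close (X ++ [:: k; u; m]) (X' ++ [:: m; u; k]) f d v R R' sG.
exists [:: k, u, m & D]; split; first by rewrite /= sD; lia.
rewrite take0 drop0; apply: sw_trans (sw3_open d f k m u v X X' G _ R R') _.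
by move: h; rewrite /= ?take0 ?drop0 -!catA.
Qed.

Lemma sumn_nseq2 l : sumn (nseq l 2) = l.*2.
Proof. by rewrite sumn_nseq mul2n. Qed.

(* [sw3_swap] leaves [2^l] inside the second 3-block; [sw_block] moves it out. *)
Lemma beq_exch l P X R :
  beq (P ++ 3 :: nseq l 2 ++ 1 :: X ++ 3 :: R) (X ++ 3 :: nseq l 2 ++ 1 :: P ++ 3 :: R).
Proof.
split; first by do 5! rewrite ?sumn_cat /=; lia.
move=> T W; do 3! rewrite /= sumn_cat /= ?sumn_nseq2.
move=> /split_size [p [W1 [-> sp]]]; rewrite ?(addSn, add0n).
case: W1 => [|c [|d [|e W2]]] //= [] /split_size [u [W1 [-> su]]]; rewrite ?(addSn, add0n).
case: W1 => [|f W3] //= [] /split_size [x [W1 [-> sx]]]; rewrite ?(addSn, add0n).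
case: W1 => [|k [|l' [|m r]]] //= [] sr.
have [D [sD h]] := sw_block x (brev X x) f k m d (p ++ [:: c; l'; e] ++ r)
  (brev P p ++ [:: e; l'; c] ++ brev R r) su.
exists (x ++ D ++ p ++ [:: c; l'; e] ++ r); split.
  by do 5! rewrite /= ?size_cat ?sumn_cat ?sumn_nseq2 /=; lia.
rewrite -[3 :: nseq l 2 ++ 1 :: P ++ _]/((3 :: nseq l 2) ++ [:: 1] ++ P ++ _) (catA (3 :: _)).
rewrite !brev_cat ?sumn_cat /= ?sumn_nseq2 ?take0 ?drop0 //; try by rewrite sD; lia.
do 2! rewrite !brev_cat ?sumn_nseq2 //= ?take0 ?drop0.
apply: sw_trans (sw3_swap c d e f k l' m p _ u _ x _ r _) _.
by move: h; rewrite /= ?take0 ?drop0 -!catA.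
Qed.

(* [c] is the previous block, reversed, without its last letter, which has
   already been switched to the right together with that block. *)
Lemma sw_rev T s (c W : seq T) x R R' : all (leq 1) s -> size W = sumn s ->
  exists D y, size D = sumn s /\
    sw (W ++ x :: R) (c ++ brev s W ++ x :: R') (D ++ y :: R) (brev (rev s) D ++ c ++ y :: R').
Proof.
elim: s c W x R R' => [|k s IH] c W x R R' /=.
  by move=> _ /size0nil ->; exists [::], x; split=> //; exact: sw_refl.
case/andP=> k0 hs /split_size [W1 [W2 [-> s1 s2]]].
case: (lastP W1) s1 => [|u e]; first by move=> /= ?; lia.
rewrite size_rcons => s1.
have [D [y [sD h]]] := IH (rev u) W2 x (u ++ e :: R) (c ++ e :: R') hs s2.
exists (D ++ y :: u), e; split; first by rewrite size_cat /= sD; lia.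
rewrite take_size_cat ?size_rcons // drop_size_cat ?size_rcons // rev_rcons rev_cons.
rewrite -[rcons (rev s) k]cats1 brev_cat ?sumn_rev // /= take_oversize /= ?s1 //.
rewrite cat_rcons rev_cons cats0 -!catA cat_rcons.
have := sw_swap u c e W2 (rev u ++ brev s W2) x R R'.
by rewrite -!catA => /sw_trans; apply.
Qed.

(** The letter [x] of the 1-block closing [s] is the right-hand switch letter throughout [sw_rev],
    which starts with an empty [c]. *)
Lemma beq_rev s R : all (leq 1) s -> beq (s ++ 1 :: R) (rev s ++ 1 :: R).
Proof.
move=> hs; split; first by rewrite !sumn_cat sumn_rev.
move=> T W; rewrite sumn_cat /= !addSn add0n => /split_size [w [W1 [-> sw1]]].
case: W1 => [|x r] //= [] sr.
have [D [y [sD h]]] := sw_rev [::] x r (brev R r) hs sw1.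
exists (D ++ y :: r); split; first by rewrite size_cat sumn_cat sumn_rev /= sD sr.
by rewrite !brev_cat ?sumn_rev //= take0 drop0.
Qed.

Ltac pcat := apply/permP=> ?; do 5! rewrite /= ?count_cat /=; lia.

(** * Chains and types *)

(* Concatenation of the chains [cs], each closed by a 1-block, and of the last
   chain [r]. *)
Definition J (cs : seq (seq nat)) (r : seq nat) := flatten [seq rcons c 1 | c <- cs] ++ r.

Lemma J_cons c cs r : J (c :: cs) r = c ++ 1 :: J cs r.
Proof. by rewrite /J /= -catA cat_rcons. Qed.

Lemma J_cat cs1 cs2 r : J (cs1 ++ cs2) r = J cs1 (J cs2 r).
Proof. by rewrite /J map_cat flatten_cat catA. Qed.

(** Isolates the first and the last chain, between which [beq4] and [beq5] transfer blocks. *)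
Lemma J_front c cs r : J (c :: cs) r = c ++ flatten [seq 1 :: d | d <- cs] ++ 1 :: r.
Proof.
elim: cs c => [|d cs IH] c; rewrite J_cons //.
by rewrite IH /= -catA.
Qed.

Lemma chains_J s : exists cs r, chains s = rcons cs r /\ s = J cs r.
Proof.
elim: s => [|x s [cs [r [e1 e2]]]]; first by exists [::], [::].
rewrite /= e1; case: eqP => [->|_].
  by exists ([::] :: cs), r; split=> //; rewrite J_cons /= -e2.
case: cs e1 e2 => [|c cs] e1 e2.
  by exists [::], (x :: r); split=> //=; rewrite e2.
by exists ((x :: c) :: cs), r; split=> //=; rewrite e2 !J_cons.
Qed.

Lemma chains_ge2 s : all (leq 1) s -> all (all (leq 2)) (chains s).
Proof.
elim: s => //= x s IH /andP[x0 /IH]; case: eqP => [//|x1].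
by case: (chains s) => [|c cs] /=; rewrite ?andbT; [lia|move=> /andP[-> ->]; lia].
Qed.

(** Permutations are generated by exchanging two adjacent initial runs of chains. Each nonempty run
    ends with a 1-block, so the exchange is one [beq_swap]. *)
Lemma J_perm cs cs' r : perm_eq cs cs' -> beq (J cs r) (J cs' r).
Proof.
move=> pe; apply: (catCA_perm_ind (P := fun t => beq (J cs r) (J t r))) pe _; last exact: beq_refl.
move=> s1 s2 s3 h; apply: beq_trans h _; rewrite !J_cat.
case: (lastP s1) => [|s1' c1]; first exact: beq_refl.
case: (lastP s2) => [|s2' c2]; first exact: beq_refl.
have e s c t : J (rcons s c) t = (flatten [seq rcons d 1 | d <- s] ++ c) ++ 1 :: t.
  by rewrite -cats1 J_cat J_cons /J -!catA.
by rewrite !e; apply: beq_swap.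
Qed.

Lemma J_rev c cs r : all (leq 1) c -> beq (J (c :: cs) r) (J (rev c :: cs) r).
Proof. by rewrite !J_cons; exact: beq_rev. Qed.

(* The cycle lengths of [calY] given the block sizes; [w] is the length of the
   path that [yseq] carries along the current chain. *)
Fixpoint cyclens (s : seq nat) (w : nat) : seq nat :=
  if s is k :: s' then
    if odd k then (w + k./2).+1 :: cyclens s' k./2 else cyclens s' (w + k)
  else [:: w.+1].

(** A 1-block closes the current cycle and carries no path further, so the chains contribute
    independently. *)
Lemma cyclens_cat1 c s w : cyclens (c ++ 1 :: s) w = cyclens c w ++ cyclens s 0.
Proof. by elim: c w => [|k c IH] w /=; rewrite ?addn0 // IH; case: odd. Qed.

Lemma cyclens_J cs r :
  cyclens (J cs r) 0 = flatten [seq cyclens c 0 | c <- cs] ++ cyclens r 0.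
Proof. by elim: cs => [//|c cs IH]; rewrite J_cons cyclens_cat1 IH /= catA. Qed.

Lemma cyclens_nseq2 m s w : cyclens (nseq m 2 ++ s) w = cyclens s (w + m.*2).
Proof. by elim: m w => [|m IH] w /=; rewrite ?addn0 // IH; congr cyclens; lia. Qed.

(** * Types 2 and 3: chains of 2-blocks with at most one 3-block *)

Definition c2 (o : nat) := nseq o 2.
Definition c3 (e : nat * nat) := nseq e.1 2 ++ 3 :: nseq e.2 2.

Lemma cyclens_c2 o : cyclens (c2 o) 0 = [:: o.*2.+1].
Proof. by rewrite /c2 -(cats0 (nseq _ _)) cyclens_nseq2. Qed.

Lemma cyclens_c3 e : cyclens (c3 e) 0 = [:: e.1.*2.+2; e.2.*2.+2].
Proof. by rewrite cyclens_nseq2 /= -(cats0 (nseq _ _)) cyclens_nseq2 /= !add0n addn1. Qed.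

Lemma cyclens_c4 m : cyclens (4 :: nseq m 2) 0 = [:: m.+2.*2.+1].
Proof. by rewrite /= -(cats0 (nseq _ _)) cyclens_nseq2 /=; congr [:: _]; lia. Qed.

Lemma cyclens_c2s ms : flatten [seq cyclens c 0 | c <- map c2 ms] = [seq o.*2.+1 | o <- ms].
Proof. by elim: ms => //= o ms ->; rewrite cyclens_c2. Qed.

Lemma cyclens_perm cs cs' : perm_eq cs cs' ->
  perm_eq (flatten [seq cyclens c 0 | c <- cs]) (flatten [seq cyclens c 0 | c <- cs']).
Proof. by move=> h; apply/perm_flatten/perm_map. Qed.

(** The lengths of the runs of 2-blocks beside the 3-blocks, forgetting how they are paired into
    chains; the cycle lengths see no more. *)
Definition ev (es : seq (nat * nat)) := flatten [seq [:: e.1; e.2] | e <- es].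

Lemma cyclens_c3s es :
  flatten [seq cyclens c 0 | c <- map c3 es] = [seq o.*2.+2 | o <- ev es].
Proof. by elim: es => //= e es ->; rewrite cyclens_c3. Qed.

Lemma J_flip m l cs r : beq (J (c3 (m, l) :: cs) r) (J (c3 (l, m) :: cs) r).
Proof.
suff -> : c3 (l, m) = rev (c3 (m, l)) by apply: J_rev; rewrite all_cat /= !all_nseq !orbT.
by rewrite /c3 rev_cat rev_cons !rev_nseq cat_rcons.
Qed.

Lemma J_exch m l m' l' cs r :
  beq (J [:: c3 (m, l), c3 (m', l') & cs] r) (J [:: c3 (m', l), c3 (m, l') & cs] r).
Proof. by rewrite !J_cons /c3 /= -?catA /= -?catA /=; apply: beq_exch. Qed.

(** With the first chain moved next to the last one, [beq_exch] applies: [P] consists of the other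
    chains followed by the left run [m]. *)
Lemma J_exch_last m l m' l' cs :
  beq (J (c3 (m, l) :: cs) (c3 (m', l'))) (J (c3 (m', l) :: cs) (c3 (m, l'))).
Proof.
have /J_perm h : perm_eq (c3 (m, l) :: cs) (cs ++ [:: c3 (m, l)]) by pcat.
apply: beq_trans (h _) _; rewrite J_cat J_cons J_cons /J /= /c3 /=.
have := beq_exch l (flatten [seq rcons c 1 | c <- cs] ++ nseq m 2) (nseq m' 2) (nseq l' 2).
by rewrite -!catA.
Qed.

Lemma J_bring x es : x \in ev es -> exists l es1, perm_eq (ev es) (x :: l :: ev es1) /\
  forall cs r, beq (J (map c3 es ++ cs) r) (J (c3 (x, l) :: map c3 es1 ++ cs) r).
Proof.
case/flatten_mapP=> -[m l] mes; have pe := perm_to_rem mes.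
have pev : perm_eq (ev es) (m :: l :: ev (rem (m, l) es)).
  by have := perm_flatten (perm_map (fun e : nat * nat => [:: e.1; e.2]) pe).
have h cs r : beq (J (map c3 es ++ cs) r) (J (c3 (m, l) :: map c3 (rem (m, l) es) ++ cs) r).
  by apply: J_perm; rewrite -cat_cons perm_cat2r; exact: (perm_map c3 pe).
rewrite !inE /= => /orP[]/eqP->; [exists l|exists m]; exists (rem (m, l) es); split=> //.
  by apply: perm_trans pev _; pcat.
by move=> cs r; apply: beq_trans (h _ _) _; exact: J_flip.
Qed.

(** Runs can be re-paired at will. The run [x] is brought to the front; if its partner is not [y], a
    chain containing [y] is brought up too and the partners are traded. The finished chain [(x, y)]
    is put aside in [cs]. *)
Lemma J_even es es' cs r : perm_eq (ev es) (ev es') ->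
  beq (J (map c3 es ++ cs) r) (J (map c3 es' ++ cs) r).
Proof.
elim: es' es cs => [|[x y] es' IH] es cs.
  by move=> /perm_size; case: es => //= *; exact: beq_refl.
move=> pe; have /J_bring[l [es1 [p1 h1]]] : x \in ev es by rewrite (perm_mem pe) inE eqxx.
have mv a t : beq (J (map c3 t ++ a :: cs) r) (J (a :: map c3 t ++ cs) r).
  by apply: J_perm; pcat.
have {pe} p2 : perm_eq (l :: ev es1) (y :: ev es').
  by move: pe; rewrite (permPl p1) /= perm_cons.
apply: beq_trans (h1 _ _) _ => /=.
case: (eqVneq l y) p2 => [->|ly p2].
  rewrite perm_cons => /IH p3; apply: beq_trans (mv _ _).
  by apply: beq_trans (p3 _); exact: beq_sym (mv _ _).
have /J_bring[k [es2 [p3 h3]]] : y \in ev es1.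
  have : y \in l :: ev es1 by rewrite (perm_mem p2) inE eqxx.
  by rewrite inE eq_sym (negbTE ly).
apply: beq_trans (beq_sym (mv _ _)) _; apply: beq_trans (h3 _ _) _.
apply: beq_trans (beq_trans _ (mv _ _)); last first.
  apply: (IH ((l, k) :: es2)).
  rewrite -[ev (_ :: _)]/[:: l, k & ev es2]; move/permP: p2 => p2; move/permP: p3 => p3; apply/permP=> a.
  by move: (p2 a) (p3 a) => /=; lia.
rewrite /=.
apply: (@beq_trans _ (J (c3 (x, l) :: c3 (y, k) :: map c3 es2 ++ cs) r)).
  by apply: J_perm; pcat.
(* Reversing, exchanging left runs and reversing again turns [(x, l), (y, k)] into
   [(x, y), (l, k)]. *)
apply: beq_trans (J_flip _ _ _ _) _; apply: beq_trans (J_exch _ _ _ _ _ _) _.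
apply: beq_trans (J_flip _ _ _ _) _.
by apply: J_perm; pcat.
Qed.

Lemma odd_inj : injective (fun x => x.*2.+1).
Proof. by move=> x y; lia. Qed.

(** The parity of a cycle length separates the runs beside 3-blocks from the chains of 2-blocks. *)
Lemma perm_even_odd E O E' O' :
  perm_eq ([seq x.*2.+2 | x <- E] ++ [seq x.*2.+1 | x <- O])
          ([seq x.*2.+2 | x <- E'] ++ [seq x.*2.+1 | x <- O']) ->
  perm_eq E E' /\ perm_eq O O'.
Proof.
have ie : injective (fun x => x.*2.+2) by move=> x y; lia.
have fe s t : [seq z <- [seq x.*2.+2 | x <- s] ++ [seq x.*2.+1 | x <- t] | odd z]
    = [seq x.*2.+1 | x <- t].
  rewrite filter_cat !filter_map (eq_filter (a2 := pred0)) ?filter_pred0.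
    by rewrite (eq_filter (a2 := predT)) ?filter_predT // => x /=; rewrite odd_double.
  by move=> x /=; rewrite odd_double.
have fo s t : [seq z <- [seq x.*2.+2 | x <- s] ++ [seq x.*2.+1 | x <- t] | ~~ odd z]
    = [seq x.*2.+2 | x <- s].
  rewrite filter_cat !filter_map (eq_filter (a2 := predT)) ?filter_predT.
    by rewrite (eq_filter (a2 := pred0)) ?filter_pred0 ?cats0 // => x /=; rewrite odd_double.
  by move=> x /=; rewrite odd_double.
move=> pe; split.
  by have := perm_filter (fun z => ~~ odd z) pe; rewrite !fo => /(perm_map_inj ie).
by have := perm_filter odd pe; rewrite !fe => /(perm_map_inj odd_inj).
Qed.

Definition lens cs := flatten [seq cyclens c 0 | c <- cs].

Lemma lens_cat cs cs' : lens (cs ++ cs') = lens cs ++ lens cs'.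
Proof. by rewrite /lens map_cat flatten_cat. Qed.

Definition even_form (cs : seq (seq nat)) :=
  exists es os, perm_eq cs (map c3 es ++ map c2 os).

Lemma even_formP cs : (forall c, c \in cs -> (exists e, c = c3 e) \/ exists o, c = c2 o) ->
  even_form cs.
Proof.
elim: cs => [|c cs IH] h; first by exists [::], [::].
have [|es [os pe]] := IH; first by move=> d dcs; apply: h; rewrite inE dcs orbT.
case: (h c (mem_head _ _)) => [[e ->]|[o ->]].
  by exists (e :: es), os; rewrite /= perm_cons.
exists es, (o :: os); apply: (@perm_trans _ (c2 o :: map c3 es ++ map c2 os)).
  by rewrite perm_cons.
by pcat.
Qed.

Lemma lens_even es os : lens (map c3 es ++ map c2 os) =
  [seq x.*2.+2 | x <- ev es] ++ [seq x.*2.+1 | x <- os].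
Proof. by rewrite lens_cat /lens cyclens_c3s cyclens_c2s. Qed.

Lemma J_even_odd es es' os os' r : perm_eq (ev es) (ev es') -> perm_eq os os' ->
  beq (J (map c3 es ++ map c2 os) r) (J (map c3 es' ++ map c2 os') r).
Proof.
move=> pe po; apply: beq_trans (J_even _ _ pe) _; apply: J_perm.
by rewrite perm_cat2l; apply: perm_map.
Qed.

(** By parity the last cycle length fixes the kind of the last chain, and its value fixes the right
    run or the number of 2-blocks there. Only the left run of a last chain with a 3-block can still
    differ; [J_exch_last] corrects it. *)
Lemma beq_even cs r cs' r' :
  even_form cs -> even_form cs' ->
  (exists e, r = c3 e) \/ (exists o, r = c2 o) ->
  (exists e, r' = c3 e) \/ (exists o, r' = c2 o) ->
  perm_eq (cyclens (J cs r) 0) (cyclens (J cs' r') 0) ->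
  last 0 (cyclens (J cs r) 0) = last 0 (cyclens (J cs' r') 0) ->
  beq (J cs r) (J cs' r').
Proof.
move=> [es [os p1]] [es' [os' p2]] hr hr' pe la.
apply: beq_trans (J_perm _ p1) _; apply: beq_trans (beq_sym (J_perm _ p2)).
move: pe la; rewrite !cyclens_J => pe la.
have {}pe : perm_eq (lens (map c3 es ++ map c2 os) ++ cyclens r 0)
                    (lens (map c3 es' ++ map c2 os') ++ cyclens r' 0).
  have := cyclens_perm p1; rewrite -(perm_cat2r (cyclens r 0)) perm_sym => /perm_trans; apply.
  by have := cyclens_perm p2; rewrite -(perm_cat2r (cyclens r' 0)); apply: perm_trans.
case: hr hr' pe la => [[[m l] ->]|[o ->]] [[[m' l'] ->]|[o' ->]];
  rewrite ?cyclens_c2 ?cyclens_c3 !last_cat /= => pe la; try by exfalso; lia.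
  have {}la : l = l' by lia.
  subst l'; move: pe; rewrite !lens_even => pe.
  have [] : perm_eq (m :: ev es) (m' :: ev es') /\ perm_eq os os'.
    apply: perm_even_odd; apply/permP=> a; move/permP: pe => /(_ a).
    by rewrite /= !count_cat /=; lia.
  move=> pE po; case: (eqVneq m m') pE => [->|mm' pE].
    by rewrite perm_cons => pE; apply: J_even_odd.
  have /J_bring[b [es1 [q1 h1]]] : m' \in ev es.
    have : m' \in m :: ev es by rewrite (perm_mem pE) inE eqxx.
    by rewrite inE eq_sym (negbTE mm').
  apply: beq_trans (h1 _ _) _; apply: beq_trans (J_exch_last _ _ _ _ _) _.
  apply: (@J_even_odd ((m, b) :: es1)) => //; apply/permP=> a.
  rewrite -[ev (_ :: _)]/[:: m, b & ev es1].
  by move/permP: pE => /(_ a); move/permP: q1 => /(_ a) /=; lia.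
have {}la : o = o' by lia.
subst o'; move: pe; rewrite perm_cat2r !lens_even => /perm_even_odd[pE po].
exact: J_even_odd.
Qed.

Lemma all2_c2 c : all (fun x => x == 2) c -> c = c2 (size c).
Proof. by move/all_pred1P. Qed.

Lemma c2s_form cs : (forall c, c \in cs -> exists o, c = c2 o) -> exists os, cs = map c2 os.
Proof.
elim: cs => [|c cs IH] h; first by exists [::].
have [|os ->] := IH; first by move=> d dcs; apply: h; rewrite inE dcs orbT.
by have [o ->] := h c (mem_head _ _); exists (o :: os).
Qed.

(** The special chain is either the last one, which [J_perm] does not move, or can be permuted to
    the front. *)
Lemma pick_chain (cs : seq (seq nat)) r (P Q : seq nat -> Prop) i :
  i < size (rcons cs r) -> P (nth [::] (rcons cs r) i) ->
  (forall j, j < size (rcons cs r) -> j != i -> Q (nth [::] (rcons cs r) j)) ->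
  (P r /\ forall c, c \in cs -> Q c) \/
  exists c cs1, [/\ perm_eq cs (c :: cs1), P c, Q r & forall c, c \in cs1 -> Q c].
Proof.
rewrite size_rcons ltnS leq_eqVlt => /orP[/eqP-> | ib] hP hQ.
  left; split; first by move: hP; rewrite nth_rcons ltnn eqxx.
  move=> c /(nthP [::])[j jb <-]; have := hQ j; rewrite nth_rcons jb.
  by apply; rewrite ?ltnS ?(ltnW jb) // neq_ltn jb.
right; exists (nth [::] cs i), (take i cs ++ drop i.+1 cs); split.
- by rewrite -{1}(cat_take_drop i cs) (drop_nth [::]) //; pcat.
- by move: hP; rewrite nth_rcons ib.
- have := hQ (size cs); rewrite nth_rcons ltnn eqxx; apply=> //.
  by rewrite neq_ltn ib orbT.
move=> c; rewrite mem_cat => /orP[] /(nthP [::])[j].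
  rewrite size_take ib => jb; rewrite nth_take // => <-.
  have := hQ j; rewrite nth_rcons (ltn_trans jb ib); apply; last by rewrite neq_ltn jb.
  by rewrite ltnS ltnW // (ltn_trans jb ib).
rewrite size_drop nth_drop => jb <-.
have jb' : i.+1 + j < size cs by rewrite -ltn_subRL.
by have := hQ (i.+1 + j); rewrite nth_rcons jb'; apply; [exact: ltnW|by rewrite neq_ltn addSn ltnS leq_addr orbT].
Qed.

(** * Type 4: moving the 4-block between chains *)

Definition c4 m := 4 :: nseq m 2.

Lemma J4_last s t ms : beq (J (c4 s :: map c2 ms) (c2 t.+2)) (J (c2 s.+2 :: map c2 ms) (c4 t)).
Proof.
rewrite !J_front /c4 /= -?catA.
have := beq4 (nseq s 2 ++ flatten [seq 1 :: d | d <- map c2 ms] ++ [:: 1]) (nseq t 2).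
by rewrite -?catA.
Qed.

Lemma J4_next s t cs r : beq (J [:: c4 s, c2 t.+2 & cs] r) (J [:: c2 s.+2, c4 t & cs] r).
Proof.
rewrite !J_cons /c4 /= -?catA.
by have := beq4 (nseq s 2 ++ [:: 1]) (nseq t 2 ++ 1 :: J cs r); rewrite -?catA.
Qed.

Definition form4 cs r :=
  (exists s ms, r = c4 s /\ cs = map c2 ms) \/
  (exists s ms o, r = c2 o /\ perm_eq cs (c4 s :: map c2 ms)).

(** A 4-block followed by [s] 2-blocks has the same cycle length as [s.+2] 2-blocks, so the lengths
    do not show which chain holds the 4-block. *)
Lemma lens_c4 s ms : lens (c4 s :: map c2 ms) = [seq o.*2.+1 | o <- s.+2 :: ms].
Proof. by rewrite /lens map_cons -[flatten _]/(cyclens (c4 s) 0 ++ lens _) cyclens_c4 /lens cyclens_c2s. Qed.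

(** The 4-block is moved to where [J cs' r'] has it: into the last chain by [J4_last], or into a
    chain of [s'.+2] 2-blocks by [J4_next]. *)
Lemma beq_form4_nl s ms o cs' r' : form4 cs' r' ->
  perm_eq ([seq x.*2.+1 | x <- s.+2 :: ms] ++ [:: o.*2.+1]) (cyclens (J cs' r') 0) ->
  o.*2.+1 = last 0 (cyclens (J cs' r') 0) ->
  beq (J (c4 s :: map c2 ms) (c2 o)) (J cs' r').
Proof.
move=> [[s' [ms' [-> ->]]]|[s' [ms' [o' [-> p2]]]]];
  rewrite cyclens_J ?cyclens_c2 ?cyclens_c4 last_cat /= => pe la.
  have {la} e : o = s'.+2 by lia.
  subst o; apply: beq_trans (J4_last _ _ _) _.
  apply: (@J_perm (map c2 (_ :: _))); apply: perm_map.
  by move: pe; rewrite cyclens_c2s -cat_cons perm_cat2r => /(@perm_map_inj _ _ _ odd_inj (_ :: _)).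
have {la} e : o = o' by lia.
subst o'; move: pe; rewrite -cat_cons perm_cat2r => pe.
have {}pe : perm_eq (s.+2 :: ms) (s'.+2 :: ms').
  apply: (perm_map_inj odd_inj); rewrite /= in pe *; apply: perm_trans pe _.
  by have := cyclens_perm p2; rewrite -/(lens (_ :: _)) lens_c4.
apply: beq_trans (beq_sym (J_perm _ p2)).
case: (eqVneq s s') pe => [->|ss pe].
  by rewrite perm_cons => pe; apply: J_perm; rewrite perm_cons; apply: perm_map.
have q1 : s'.+2 \in ms.
  have : s'.+2 \in s.+2 :: ms by rewrite (perm_mem pe) inE eqxx.
  by rewrite inE !eqSS eq_sym (negbTE ss).
have q2 := perm_to_rem q1.
apply: (@beq_trans _ (J [:: c4 s, c2 s'.+2 & map c2 (rem s'.+2 ms)] (c2 o))).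
  by apply: J_perm; rewrite perm_cons; exact: (perm_map c2 q2).
apply: beq_trans (J4_next _ _ _ _) _.
apply: (@J_perm (_ :: _)).
apply: (@perm_trans _ (c4 s' :: map c2 (s.+2 :: rem s'.+2 ms))); first by pcat.
rewrite perm_cons; apply: perm_map; apply/permP=> a.
by move/permP: pe => /(_ a); move/permP: q2 => /(_ a) /=; lia.
Qed.

Lemma beq_form4 cs r cs' r' : form4 cs r -> form4 cs' r' ->
  perm_eq (cyclens (J cs r) 0) (cyclens (J cs' r') 0) ->
  last 0 (cyclens (J cs r) 0) = last 0 (cyclens (J cs' r') 0) ->
  beq (J cs r) (J cs' r').
Proof.
move=> h h' pe la.
have key ds s ms o es t : perm_eq ds (c4 s :: map c2 ms) -> form4 es t ->
    perm_eq (cyclens (J ds (c2 o)) 0) (cyclens (J es t) 0) ->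
    last 0 (cyclens (J ds (c2 o)) 0) = last 0 (cyclens (J es t) 0) ->
    beq (J ds (c2 o)) (J es t).
  move=> p1 ft {}pe {}la; apply: beq_trans (J_perm _ p1) _; apply: beq_form4_nl ft _ _.
    apply: perm_trans pe; rewrite cyclens_J cyclens_c2 perm_cat2r perm_sym -lens_c4.
    exact: cyclens_perm.
  by rewrite -la cyclens_J cyclens_c2 last_cat.
have h1 := h; have h2 := h'.
case: h1 => [[s [ms [e1 e2]]]|[s [ms [o [e p1]]]]]; last by subst r; exact: key p1 h' pe la.
case: h2 => [[s' [ms' [e1' e2']]]|[s' [ms' [o [e p1]]]]].
  move: pe la; subst r cs r' cs'; rewrite !cyclens_J !cyclens_c4 !last_cat /= => pe la.
  have {la} e : s = s' by lia.
  subst s'; move: pe; rewrite perm_cat2r !cyclens_c2s => /(perm_map_inj odd_inj) pe.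
  by apply: J_perm; apply: perm_map.
by subst r'; apply: beq_sym; apply: key p1 h _ _; rewrite // perm_sym.
Qed.

(** * Type 5: exchanging the 5-block with a 2-block *)

Definition c5 : seq nat := [:: 5].

Lemma J5_last ms : beq (J (c5 :: map c2 ms) (c2 1)) (J (c2 1 :: map c2 ms) c5).
Proof.
rewrite !J_front; have := beq5 (flatten [seq 1 :: d | d <- map c2 ms]) [::].
by rewrite /c5 /c2 /= -?catA.
Qed.

Definition form5 cs r :=
  (exists ms, r = c5 /\ cs = map c2 ms) \/
  (exists ms o, r = c2 o /\ perm_eq cs (c5 :: map c2 ms)).

Lemma lens_c5 ms : lens (c5 :: map c2 ms) = [:: 3, 3 & [seq o.*2.+1 | o <- ms]].
Proof. by rewrite /lens /= cyclens_c2s. Qed.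

(** If the 5-block is in the last chain on one side only, the last cycle length 3 forces the other
    last chain to be a single 2-block, and [J5_last] exchanges the two. *)
Lemma beq_form5 cs r cs' r' : form5 cs r -> form5 cs' r' ->
  perm_eq (cyclens (J cs r) 0) (cyclens (J cs' r') 0) ->
  last 0 (cyclens (J cs r) 0) = last 0 (cyclens (J cs' r') 0) ->
  beq (J cs r) (J cs' r').
Proof.
have key ds ms o es : perm_eq ds (c5 :: map c2 ms) ->
    perm_eq (cyclens (J ds (c2 o)) 0) (cyclens (J (map c2 es) c5) 0) ->
    last 0 (cyclens (J ds (c2 o)) 0) = 3 ->
    beq (J ds (c2 o)) (J (map c2 es) c5).
  move=> p1 + la; have e : o = 1 by move: la; rewrite cyclens_J cyclens_c2 last_cat /=; lia.
  subst o => pe; apply: beq_trans (J_perm _ p1) _; apply: beq_trans (J5_last _) _.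
  apply: (@J_perm (map c2 (_ :: _))); apply: perm_map; apply: (perm_map_inj odd_inj).
  move: pe; rewrite !cyclens_J cyclens_c2 cyclens_c2s => pe.
  have p2 := cyclens_perm p1; rewrite -/(lens (_ :: _)) lens_c5 in p2.
  apply/permP=> a; move/permP: pe => /(_ a); move/permP: p2 => /(_ a) /=.
  by rewrite !count_cat /= -[1.*2.+1]/3 -[(0 + 2).+1]/3; lia.
move=> [[ms [-> ->]]|[ms [o [-> p1]]]] [[ms' [-> ->]]|[ms' [o' [-> p2]]]] pe la.
- move: pe; rewrite !cyclens_J perm_cat2r !cyclens_c2s => /(perm_map_inj odd_inj) pe.
  by apply: J_perm; apply: perm_map.
- apply: beq_sym; apply: key p2 _ _; first by rewrite perm_sym.
  by rewrite -la cyclens_J last_cat.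
- by apply: key p1 pe _; rewrite la cyclens_J last_cat.
move: pe la; rewrite !cyclens_J !cyclens_c2 !last_cat /= => pe la.
have {la} e : o = o' by lia.
subst o'; move: pe; rewrite perm_cat2r => pe.
apply: beq_trans (J_perm _ p1) _; apply: beq_trans (beq_sym (J_perm _ p2)).
apply: J_perm; rewrite perm_cons; apply: perm_map; apply: (perm_map_inj odd_inj).
have q1 := cyclens_perm p1; rewrite -/(lens (_ :: _)) lens_c5 in q1.
have q2 := cyclens_perm p2; rewrite -/(lens (_ :: _)) lens_c5 in q2.
apply/permP=> a; move/permP: pe => /(_ a); move/permP: q1 => /(_ a).
by move/permP: q2 => /(_ a) /=; lia.
Qed.

(** * Type 1: at most one nonempty chain *)

Definition form1 cs r :=
  [\/ exists j, r = [::] /\ cs = nseq j [::],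
      exists j k, [/\ 2 <= k, r = [::] & perm_eq cs ([:: k] :: nseq j [::])] |
      exists j k, [/\ 2 <= k, r = [:: k] & cs = nseq j [::]]].

Lemma nil_chains (cs : seq (seq nat)) : count (fun c => c != [::]) cs = 0 -> cs = nseq (size cs) [::].
Proof. by elim: cs => //= -[|x c] cs IH //=; rewrite add0n => /IH {1}->. Qed.

Lemma form1P cs r : (forall c, c \in rcons cs r -> all (leq 2) c) ->
  count (fun c => c != [::]) (rcons cs r) <= 1 ->
  (forall c, c \in rcons cs r -> c != [::] -> size c = 1) -> form1 cs r.
Proof.
move=> h2 hc h1.
have single c : c \in rcons cs r -> c != [::] -> exists2 k, 2 <= k & c = [:: k].
  move=> cin cn; move: (h2 c cin) (h1 c cin cn).
  by case: c {cin cn} => [|k [|]] //=; rewrite andbT; exists k.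
have rin : r \in rcons cs r by rewrite mem_rcons mem_head.
move: hc; rewrite -cats1 count_cat /= addn0.
case: (eqVneq r [::]) => [r0|rn] /=; last first.
  rewrite addn1 ltnS leqn0 => /eqP/nil_chains e.
  by have [k k2 er] := single r rin rn; apply: Or33; exists (size cs), k.
rewrite addn0; case e: (count _ cs) => [|[|n]] // _.
  by apply: Or31; exists (size cs); split=> //; apply: nil_chains.
have /hasP[c cin cn] : has (fun c => c != [::]) cs by rewrite has_count e.
have cin' : c \in rcons cs r by rewrite mem_rcons inE cin orbT.
have [k k2 ec] := single c cin' cn.
have pe := perm_to_rem cin; have := permP pe (fun c => c != [::]).
rewrite e /= cn => -[/esym/nil_chains er]; apply: Or32; exists (size (rem c cs)), k; split=> //.
by rewrite -er -ec.
Qed.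

Lemma sumn_J cs r : sumn (J cs r) = sumn (map sumn cs) + size cs + sumn r.
Proof. by elim: cs => [//|c cs IH]; rewrite J_cons sumn_cat /= IH; lia. Qed.

Lemma cyclens1 k : 2 <= k ->
  count_mem 1 (cyclens [:: k] 0) = 0 /\ 2 <= last 0 (cyclens [:: k] 0).
Proof. by move=> k2 /=; case: ifP => ko /=; split; lia. Qed.

Lemma lens_nil j : lens (nseq j [::]) = nseq j 1.
Proof. by elim: j => // j IH; rewrite -[lens _]/(1 :: lens (nseq j [::])) IH. Qed.

(** Three numbers determine the form. Cycles of length 1 count the empty chains, as a [k]-block with
    [k >= 2] yields none; the total size then gives [k]; the last length exceeds 1 exactly when the
    [k]-block is in the last chain. *)
Lemma beq_form1 cs r cs' r' : form1 cs r -> form1 cs' r' ->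
  sumn (J cs r) = sumn (J cs' r') ->
  perm_eq (cyclens (J cs r) 0) (cyclens (J cs' r') 0) ->
  last 0 (cyclens (J cs r) 0) = last 0 (cyclens (J cs' r') 0) ->
  beq (J cs r) (J cs' r').
Proof.
pose inv cs r := (sumn (J cs r), count_mem 1 (cyclens (J cs r) 0), last 0 (cyclens (J cs r) 0)).
have i1 j : inv (nseq j [::]) [::] = (j, j.+1, 1).
  rewrite /inv cyclens_J -/(lens _) lens_nil sumn_J map_nseq sumn_nseq size_nseq count_cat count_nseq /= last_cat /=.
  by congr (_, _, _); lia.
have i2 cs0 j k : 2 <= k -> perm_eq cs0 ([:: k] :: nseq j [::]) -> inv cs0 [::] = (k + j.+1, j.+1, 1).
  move=> /cyclens1[c1 _] pe.
  rewrite /inv cyclens_J sumn_J (perm_sumn (perm_map sumn pe)) (perm_size pe) count_cat last_cat.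
  rewrite (permP (cyclens_perm pe)) /= -/(lens _) lens_nil count_cat count_nseq.
  rewrite map_nseq sumn_nseq size_nseq.
  rewrite [count _ (if _ then _ else _)]c1 /=.
  by congr (_, _, _); lia.
have i3 j k : 2 <= k -> exists2 x, 2 <= x & inv (nseq j [::]) [:: k] = (k + j, j, x).
  move=> /cyclens1[c1 l1]; exists (last 0 (cyclens [:: k] 0)) => //.
  rewrite /inv cyclens_J -/(lens _) lens_nil sumn_J map_nseq sumn_nseq size_nseq count_cat count_nseq c1 last_cat.
  congr (_, _, _); rewrite /=; try lia.
  by case: ifP.
move=> f f' es /permP/(_ (pred1 1)) ec el.
have {es ec el} : inv cs r = inv cs' r' by rewrite /inv es ec el.
case: f => [[j [-> ->]]|[j [k [k2 -> pe]]]|[j [k [k2 -> ->]]]];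
case: f' => [[j' [-> ->]]|[j' [k' [k2' -> pe']]]|[j' [k' [k2' -> ->]]]].
- by rewrite !i1 => -[-> *]; exact: beq_refl.
- by rewrite i1 (i2 _ _ _ k2' pe') => -[]; lia.
- by rewrite i1; have [x x2 ->] := i3 j' _ k2' => -[]; lia.
- by rewrite i1 (i2 _ _ _ k2 pe) => -[]; lia.
- rewrite (i2 _ _ _ k2 pe) (i2 _ _ _ k2' pe') => -[] e1 e2.
  have {e1} e : k = k' by lia.
  subst j' k'; apply: J_perm; apply: perm_trans pe _; by rewrite perm_sym.
- by rewrite (i2 _ _ _ k2 pe); have [x x2 ->] := i3 j' _ k2' => -[]; lia.
- by rewrite i1; have [x x2 ->] := i3 j _ k2 => -[]; lia.
- by rewrite (i2 _ _ _ k2' pe'); have [x x2 ->] := i3 j _ k2 => -[]; lia.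
have [x x2 ->] := i3 j _ k2; have [x' x2' ->] := i3 j' _ k2'.
move=> -[] e1 e2 _; have e : k = k' by lia.
by subst j' k'; exact: beq_refl.
Qed.

(** * From the types to the equivalence of block sizes *)

Lemma type23_form t s cs r : t = 2 \/ t = 3 -> type_n t s -> chains s = rcons cs r ->
  even_form cs /\ ((exists e, r = c3 e) \/ (exists o, r = c2 o)).
Proof.
move=> ht ty es.
have h c : c \in rcons cs r -> (exists e, c = c3 e) \/ (exists o, c = c2 o).
  rewrite -es => cin; case: ht ty => -> /=.
    by case=> _ /(_ c cin)/all2_c2 ->; right; exists (size c).
  case=> _ /(_ c cin) hc _; case: (eqVneq c [::]) hc => [->|cn] hc.
    by right; exists 0.
  case: (hc isT) => [[m [l ->]]|[m [_ ->]]]; first by left; exists (m, l).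
  by right; exists m.
split; last by apply: h; rewrite mem_rcons mem_head.
by apply: even_formP => c cin; apply: h; rewrite mem_rcons inE cin orbT.
Qed.

Lemma type4_form s cs r : type4 s -> chains s = rcons cs r -> form4 cs r.
Proof.
case=> _ [i ib [hi hj]] es; rewrite es in ib hi hj.
have := @pick_chain cs r (fun c => exists m, c = 4 :: nseq m 2) (fun c => exists o, c = c2 o) i ib hi.
case=> [j jb ji|[[m ->] h]|[c [cs1 [pe [m ec] [o ->] h]]]].
- by exists (size (nth [::] (rcons cs r) j)); apply: all2_c2; apply: hj.
- by left; have [ms ->] := c2s_form h; exists m, ms.
have [ms e] := c2s_form h.
by right; exists m, ms, o; split=> //; rewrite -e /c4 -ec.
Qed.

Lemma type5_form s cs r : type5 s -> chains s = rcons cs r -> form5 cs r.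
Proof.
case=> _ [i ib [hi hj]] es; rewrite es in ib hi hj.
have := @pick_chain cs r (fun c => c = c5) (fun c => exists o, c = c2 o) i ib hi.
case=> [j jb ji|[-> h]|[c [cs1 [pe ec [o ->] h]]]].
- by case: (hj j jb ji) => ->; [exists 0|exists 1].
- by left; have [ms ->] := c2s_form h; exists ms.
have [ms e] := c2s_form h.
by right; exists ms, o; split=> //; rewrite -e -ec.
Qed.

Lemma type1_form s cs r : all (leq 1) s -> type1 s -> chains s = rcons cs r -> form1 cs r.
Proof.
move=> /chains_ge2/allP h2 [hc h1] es; rewrite es in h2 hc h1.
exact: form1P.
Qed.

Lemma beq_type t s s' : all (leq 1) s -> all (leq 1) s' -> sumn s = sumn s' ->
  type_n t s -> type_n t s' ->
  perm_eq (cyclens s 0) (cyclens s' 0) ->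
  last 0 (cyclens s 0) = last 0 (cyclens s' 0) -> beq s s'.
Proof.
have [cs [r [e1 e2]]] := chains_J s; have [cs' [r' [e1' e2']]] := chains_J s'.
move=> p p' es ty ty'.
have [t1|[t23|[t4|t5]]] : t = 1 \/ (t = 2 \/ t = 3) \/ t = 4 \/ t = 5.
- by case: t ty {ty'} => [|[|[|[|[|[|]]]]]] //=; lia.
- subst t; have := type1_form p ty e1; have := type1_form p' ty' e1'.
  by rewrite -> e2 in es |- *; rewrite -> e2' in es |- *; move=> f f' pe la; apply: beq_form1.
- have [f h] := type23_form t23 ty e1; have [f' h'] := type23_form t23 ty' e1'.
  by rewrite e2 e2' => pe la; apply: beq_even.
- subst t; have := type4_form ty e1; have := type4_form ty' e1'.
  by rewrite e2 e2' => f f' pe la; apply: beq_form4.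
subst t; have := type5_form ty e1; have := type5_form ty' e1'.
by rewrite e2 e2' => f f' pe la; apply: beq_form5.
Qed.

(** * Cycles as sequences of positions *)

(** Every second one of the [k] positions from [lo] on, whatever the parity of [lo]: inside a
    reversed block [calY] advances by two. *)
Fixpoint odds (lo k : nat) : seq nat :=
  match k with 0 => [::] | 1 => [:: lo] | k'.+2 => lo :: odds lo.+2 k' end.

Lemma oddsS lo k : odds lo k.+1 = lo :: odds lo.+2 k.-1.
Proof. by case: k. Qed.

Lemma size_odds lo k : size (odds lo k) = uphalf k.
Proof.
suff [] : size (odds lo k) = uphalf k /\ size (odds lo k.+1) = uphalf k.+1 by [].
elim: k lo => [|k IH] lo //; split; first by case: (IH lo).
by rewrite /=; case: (IH lo.+2) => ->.
Qed.

Lemma odds_perm lo k : perm_eq (odds lo k ++ odds lo.+1 k.-1) (iota lo k).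
Proof.
elim: k lo => // k IH lo; rewrite oddsS /= perm_cons.
by rewrite perm_catC; exact: IH.
Qed.

Lemma odds_rcons lo k : odds lo k.*2.+1 = rcons (odds lo k.*2) (lo + k.*2).
Proof.
elim: k lo => [|k IH] lo; first by rewrite addn0.
rewrite doubleS -[odds lo _.+3]/(lo :: odds lo.+2 k.*2.+1) IH.
by rewrite -[odds lo _.+2]/(lo :: odds lo.+2 _) !addSn !addnS.
Qed.

Lemma sorted_odds (E : rel nat) lo k :
  (forall j, lo <= j -> j.+1 < lo + k.*2 -> E j j.+2) -> sorted E (odds lo k.*2.+1).
Proof.
elim: k lo => [|k IH] lo h //.
rewrite doubleS -[odds lo _.+3]/(lo :: odds lo.+2 k.*2.+1).
have := IH lo.+2; rewrite oddsS /= => ->; first by rewrite h // doubleS; lia.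
by move=> j j1 j2; apply: h; lia.
Qed.

(* Each cycle is built up while reading the blocks: [w] is the path leading
   from the second letter of the last block read to the next block. *)
Fixpoint yseq (lo : nat) (s w : seq nat) : seq (seq nat) :=
  if s is k :: s' then
    if odd k then (w ++ odds lo k) :: yseq (lo + k) s' (odds lo.+1 k.-1)
    else yseq (lo + k) s' (odds lo.+1 k.-1 ++ w ++ odds lo k)
  else [:: rcons w lo].

Lemma size_yseq lo s w : map size (yseq lo s w) = cyclens s (size w).
Proof.
elim: s lo w => [|k s IH] lo w /=; first by rewrite size_rcons.
case: ifP => ko /=; rewrite IH ?size_cat !size_odds; last first.
  by case: k ko => //= k; rewrite uphalfE => ko; congr cyclens; lia.
by case: k ko => //= k ko; congr (_ :: cyclens _ _); lia.
Qed.

Lemma yseq_perm lo s w : all (leq 1) s ->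
  perm_eq (flatten (yseq lo s w)) (w ++ iota lo (sumn s).+1).
Proof.
elim: s lo w => [|k s IH] lo w /=; first by rewrite cats0 cats1.
case/andP=> k0 hs; rewrite -[lo :: iota _ _]/(iota lo (k + sumn s).+1) -addnS iotaD; have ho := odds_perm lo k.
case: ifP => ko /=; [have h := IH (lo + k) (odds lo.+1 k.-1) hs|
  have h := IH (lo + k) (odds lo.+1 k.-1 ++ w ++ odds lo k) hs];
  apply/permP=> a; move/permP: ho => /(_ a); move/permP: h => /(_ a);
  rewrite /= !count_cat /=; lia.
Qed.

Section Glue.
Variables (T : Type) (E : rel T).

Lemma sorted_glue s1 s2 x : sorted E (rcons s1 x) -> sorted E (x :: s2) -> sorted E (s1 ++ x :: s2).
Proof. by rewrite sorted_cat_cons => -> /= ->. Qed.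

Lemma sorted_link d x s1 s2 : sorted E s1 -> sorted E (x :: s2) ->
  (0 < size s1 -> E (last d s1) x) -> sorted E (s1 ++ x :: s2).
Proof.
move=> h1 h2 h; apply: sorted_glue => //; case: s1 h1 h => //= y s1 h1 /(_ isT) h.
by rewrite rcons_path h1.
Qed.

Lemma cycle_link d s : sorted E s -> E (last d s) (head d s) -> cycle E s.
Proof. by case: s => //= x s h1 h2; rewrite rcons_path h1. Qed.

End Glue.

Lemma path_sub_in (T : eqType) (e e' : rel T) x t : path e x t ->
  (forall i j, i \in belast x t -> e i j -> e' i j) -> path e' x t.
Proof.
elim: t x => //= y t IH x /andP[xy h] sub; rewrite sub ?mem_head //=.
by apply: IH h _ => i j ib; apply: sub; rewrite inE ib orbT.
Qed.

(** * Cycle lengths counted by canonical roots *)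

Lemma roots_cycle (T : finType) (f : T -> T) (c : seq T) :
  fcycle f c -> uniq c -> 0 < size c ->
  [seq order f x | x <- c & froot f x == x] = [:: size c].
Proof.
move=> fc uc; case: c fc uc => // x0 c; set s := x0 :: c => fc uc _.
have [r rs er] : exists2 r, r \in s & forall x, x \in s -> froot f x = r.
  case e : [pick y in s] => [r|]; last first.
    by move: e; case: pickP => // /(_ x0); rewrite inE eqxx.
  exists r; first by move: e; case: pickP => // y ys [<-].
  move=> x xs; rewrite /root (eq_pick (Q := [pred y in s])) ?e //.
  by move=> y /=; rewrite (fconnect_cycle fc xs).
rewrite (eq_in_filter (a2 := pred1 r)); last by move=> x xs /=; rewrite er // eq_sym.
by rewrite filter_pred1_uniq //= (order_cycle fc uc rs).
Qed.

Lemma orders_cycles (T : finType) (f : T -> T) (P : pred T) (cs : seq (seq T)) :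
  all (fcycle f) cs -> all (fun c => 0 < size c) cs ->
  perm_eq (flatten cs) (filter P (enum T)) ->
  perm_eq [seq order f x | x <- enum T & P x && (froot f x == x)] (map size cs).
Proof.
move=> fc pc pe; have uc : uniq (flatten cs).
  by rewrite (perm_uniq pe) filter_uniq // enum_uniq.
have -> : [seq x <- enum T | P x && (froot f x == x)] =
    [seq x <- [seq x <- enum T | P x] | froot f x == x].
  by rewrite -filter_predI; apply: eq_filter => x /=; rewrite andbC.
have /(perm_map (order f)) := perm_filter (fun x => froot f x == x) pe.
rewrite perm_sym => /perm_trans; apply.
suff -> : [seq order f x | x <- flatten cs & froot f x == x] = map size cs by [].
elim: cs fc pc uc {pe} => //= c cs IH /andP[fc fcs] /andP[pc pcs].
rewrite cat_uniq => /and3P[uc _ ucs].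
by rewrite filter_cat map_cat IH // roots_cycle.
Qed.

Lemma cyclens_pos s w : all (leq 1) (cyclens s w).
Proof. by elim: s w => //= k s IH w; case: ifP => /= _; exact: IH. Qed.

Lemma yseq_neq0 lo s w : yseq lo s w <> [::].
Proof. by elim: s lo w => //= k s IH lo w; case: ifP. Qed.

Lemma last_yseq lo s w : exists w', last [::] (yseq lo s w) = rcons w' (lo + sumn s).
Proof.
elim: s lo w => [|k s IH] lo w /=; first by exists w; rewrite addn0.
rewrite addnA; case: ifP => _; last exact: IH.
have [w' e] := IH (lo + k) (odds lo.+1 k.-1); exists w'; rewrite -e /=.
by case: yseq (@yseq_neq0 (lo + k) s (odds lo.+1 k.-1)).
Qed.

(** * Rauzy moves on rows *)

Section Rows.
Variable A : finType.
Implicit Types (p : pair A) (t b : seq A).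

Definition rows p t b := map p.1 t = iota 1 #|A| /\ map p.2 b = iota 1 #|A|.

Lemma rows_mem (f : A -> nat) t x : map f t = iota 1 #|A| -> x \in t.
Proof.
move=> e; have u : uniq t by apply: (@map_uniq _ _ f); rewrite e iota_uniq.
have st : size t = #|A| by rewrite -(size_map f) e size_iota.
have [_ ->] : (size t = size (enum A)) * (t =i enum A); last by rewrite mem_enum.
by apply: uniq_min_size => //; [move=> y; rewrite mem_enum|rewrite -cardE st].
Qed.

Lemma iota_inj (f : A -> nat) t : map f t = iota 1 #|A| -> injective f.
Proof.
move=> e x y fxy; have it z : z \in t := rows_mem z e.
have /(uniqP 0) u : uniq (map f t) by rewrite e iota_uniq.
rewrite -(nth_index x (it x)) -(nth_index x (it y)); congr nth.
apply: u; rewrite ?inE ?size_map ?index_mem //.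
by rewrite !(nth_map x) ?index_mem // !nth_index.
Qed.

Lemma pinv_inj (f : A -> nat) x : injective f -> pinv f (f x) = Some x.
Proof.
by move=> fi; rewrite /pinv; case: pickP => [y /eqP/fi-> //|/(_ x)]; rewrite eqxx.
Qed.

Lemma iota_last (f : A -> nat) t z : map f (rcons t z) = iota 1 #|A| -> f z = #|A|.
Proof.
move=> e; have sn : #|A| = (size t).+1.
  by rewrite -(size_iota 1 #|A|) -e size_map size_rcons.
have := congr1 (fun s => nth 0 s (size t)) e.
by rewrite map_rcons nth_rcons size_map ltnn eqxx sn nth_iota // add1n.
Qed.

Lemma rows_rauzy p t z b1 b2 c : rows p (rcons t z) (b1 ++ z :: rcons b2 c) ->
  rows (rauzy false p) (rcons t z) (b1 ++ z :: c :: b2).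
Proof.
move=> [e1 e2]; have fi := iota_inj e1.
have fz := iota_last e1.
rewrite /rauzy /= -{1}fz pinv_inj //=; split=> //=.
have sb : #|A| = size b1 + (size b2).+2.
  by rewrite -(size_iota 1 #|A|) -e2 size_map size_cat /= size_rcons.
have ei : iota 1 #|A| = iota 1 (size b1) ++ (size b1).+1 :: rcons (iota (size b1).+2 (size b2)) #|A|.
  have -> : iota 1 #|A| = iota 1 (size b1 + 1 + size b2 + 1) by congr iota; lia.
  rewrite !iotaD -!catA -cats1 !add1n !addn1 /=; congr (_ ++ _ :: _ ++ [:: _]).
  by rewrite sb; lia.
have ei' : iota 1 #|A| = iota 1 (size b1) ++ [:: (size b1).+1, (size b1).+2 & iota (size b1).+3 (size b2)].
  by rewrite sb iotaD.
move: e2; rewrite map_cat /= map_rcons ei => /eqP.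
rewrite eqseq_cat ?size_map ?size_iota // => /andP[/eqP h1].
rewrite eqseq_cons => /andP[/eqP hz]; rewrite eqseq_rcons => /andP[/eqP h2 /eqP hc].
rewrite -ei ei' map_cat /= hz leqnn; congr (_ ++ _ :: _).
  rewrite -h1; apply/eq_in_map => x xb; have : p.2 x \in map p.2 b1 by apply: map_f.
  by rewrite h1 mem_iota => /andP[_ h]; rewrite ifT //; lia.
rewrite hc ltnn ifF; last by lia.
congr (_ :: _).
(* The letters between [z] and [c] move one place to the right. *)
transitivity (map succn (map p.2 b2)).
  rewrite -map_comp; apply/eq_in_map => x xb; have : p.2 x \in map p.2 b2 by apply: map_f.
  rewrite h2 mem_iota => /andP[h3 h4] /=; rewrite ifF; last by lia.
  by rewrite ifT // sb; move: h4; rewrite !addnS.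
by rewrite h2 -[(size b1).+3]add1n iotaDl.
Qed.

Lemma reach_trans p q r : reach p q -> reach q r -> reach p r.
Proof. by move=> pq; elim=> // r' e _ h; apply: reach_step. Qed.

Definition flip p : pair A := (p.2, p.1).

Lemma rauzy_flip e p : rauzy e (flip p) = flip (rauzy (~~ e) p).
Proof. by case: e; rewrite /rauzy /=; case: pinv. Qed.

Lemma reach_flip p q : reach p q -> reach (flip p) (flip q).
Proof.
elim=> [|r e _ h]; first exact: reach_refl.
by rewrite -[e]negbK -rauzy_flip; apply: reach_step.
Qed.

(** Each move carries the last letter of the lower row to the place right after [z]; it is repeated
    once for each letter of [Y]. *)
Lemma reach_rot p t z b1 X Y : rows p (rcons t z) (b1 ++ z :: X ++ Y) ->
  exists q, reach p q /\ rows q (rcons t z) (b1 ++ z :: Y ++ X).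
Proof.
elim/last_ind: Y X p => [|Y c IH] X p.
  by rewrite cats0 => h; exists p; split=> //; exact: reach_refl.
rewrite -rcons_cat => /rows_rauzy; rewrite -cat_cons => /IH[q [h1 h2]].
exists q; split; last by rewrite cat_rcons.
by apply: reach_trans h1; apply: reach_step; exact: reach_refl.
Qed.

Lemma reach_rot_flip p b z t1 X Y : rows p (t1 ++ z :: X ++ Y) (rcons b z) ->
  exists q, reach p q /\ rows q (t1 ++ z :: Y ++ X) (rcons b z).
Proof.
move=> [e1 e2]; have [|q [/reach_flip r [h1 h2]]] := @reach_rot (flip p) b z t1 X Y.
  by split.
by exists (flip q); split; first by move: r; case: (p).
Qed.

Lemma reach_sw W V W' V' : sw W V W' V' -> forall p a z,
  rows p (a :: rcons W z) (z :: rcons V a) ->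
  exists q, reach p q /\ rows q (a :: rcons W' z) (z :: rcons V' a).
Proof.
elim=> {W V W' V'} [W V|W V W' V' W'' V'' _ h1 _ h2|P1 P2 x Q1 Q2 y R1 R2] p a z.
- by move=> h; exists p; split=> //; exact: reach_refl.
- move=> /h1[q [r1 /h2[q' [r2 h]]]]; exists q'; split=> //; exact: reach_trans r1 r2.
move=> h.
(* The four runs have [z], [x], [y], [a] as winning letters. In turn they make the lower row
   [z Q2 y R2 a P2 x], the upper row [a P1 x R1 z Q1 y], the lower row [z Q2 y P2 x R2 a] and the
   upper row [a Q1 y P1 x R1 z]. *)
have [q1 [r1 {}h]] : exists q, reach p q /\ rows q (a :: P1 ++ x :: rcons Q1 y ++ rcons R1 z)
    (rcons (z :: Q2 ++ y :: R2 ++ a :: P2) x).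
  have [|q [r hq]] := @reach_rot p (a :: P1 ++ x :: Q1 ++ y :: R1) z [::]
     (rcons P2 x) (Q2 ++ y :: rcons R2 a).
    by move: h; rewrite -!cats1 /= -?catA /= -?catA.
  by exists q; split=> //; move: hq; rewrite -!cats1 /= -?catA /= -?catA /= -?catA.
have [q2 [r2 {}h]] := reach_rot_flip (t1 := a :: P1) h.
have [q3 [r3 {}h]] : exists q, reach q2 q /\ rows q (a :: (P1 ++ x :: rcons R1 z) ++ rcons Q1 y)
    (rcons (z :: Q2 ++ y :: P2 ++ x :: R2) a).
  have [|q [r hq]] := @reach_rot q2 (a :: P1 ++ x :: R1 ++ z :: Q1) y (z :: Q2)
     (rcons R2 a) (rcons P2 x).
    by move: h; rewrite -!cats1 /= -?catA /= -?catA /= -?catA.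
  by exists q; split=> //; move: hq; rewrite -!cats1 /= -?catA /= -?catA /= -?catA.
have [q4 [r4 {}h]] := reach_rot_flip (t1 := [::]) h.
exists q4; split.
  exact: reach_trans (reach_trans (reach_trans r1 r2) r3) r4.
by move: h; rewrite -!cats1 /= -?catA /= -?catA /= -?catA.
Qed.

(** * Invariance under renaming of letters *)

Lemma perm_word_rows p q (g : A -> A) t b :
  rows p t b -> rows q (map g t) (map g b) -> perm_word p = perm_word q.
Proof.
have pw r u c : rows r u c -> perm_word r = map r.2 u.
  move=> [e _]; rewrite /perm_word -e -map_comp; apply: eq_map => x /=.
  by rewrite pinv_inj //; exact: iota_inj e.
move=> h h'; rewrite (pw _ _ _ h) (pw _ _ _ h') -map_comp; apply: eq_map => x.
move: h h' => [_ e] [_ e']; move: e' (rows_mem x e); rewrite -e -map_comp.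
by move=> /eq_in_map h xb; rewrite -(h x xb).
Qed.

Lemma rows_rauzy2 e p q (g : A -> A) t b :
  rows p t b -> rows q (map g t) (map g b) ->
  exists t' b', rows (rauzy e p) t' b' /\ rows (rauzy e q) (map g t') (map g b').
Proof.
have key p' q' u c : rows p' u c -> rows q' (map g u) (map g c) ->
    exists t' b', rows (rauzy false p') t' b' /\ rows (rauzy false q') (map g t') (map g b').
  case: (lastP u) => [|{}u z] h.
    move=> h'; exists [::], [::]; case: h h' => /= e1 e2 [e3 e4].
    have A0 : #|A| = 0 by rewrite -(size_iota 1 #|A|) -e1.
    by rewrite /rows A0.
  have zc : z \in c by case: h => _ /(rows_mem z).
  case/splitPr: zc h => b1 b2; case: (lastP b2) => [|{}b2 d] h; last first.
    move=> h'; exists (rcons u z), (b1 ++ z :: d :: b2); split; first exact: rows_rauzy.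
    by move: h'; rewrite !map_rcons !map_cat /= !map_rcons => /rows_rauzy.
  move=> h'; exists (rcons u z), (b1 ++ [:: z]).
  (* When both rows end with the same letter, the move changes nothing. *)
  have same r v y c1 : rows r (rcons v y) (c1 ++ [:: y]) -> rows (rauzy false r) (rcons v y) (c1 ++ [:: y]).
    move=> [e1 e2]; have fi := iota_inj e1.
    have fy := iota_last e1.
    have gy : r.2 y = #|A| by apply: (@iota_last _ c1); rewrite -cats1.
    rewrite /rauzy /= -{1}fy pinv_inj //=; split=> //=.
    rewrite -e2; apply: eq_map => x; rewrite gy ifT //.
    have : r.2 x \in map r.2 (c1 ++ [:: y]) by apply: map_f; exact: rows_mem e2.
    by rewrite e2 mem_iota add1n ltnS => /andP[].
  split; first exact: same.
  by move: h'; rewrite !map_rcons !map_cat => /same.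
move=> h h'; case: e; last exact: key h h'.
case: h h' => e1 e2 [e3 e4].
have [|| b' [t' [[h1 h2] [h3 h4]]]] := key (flip p) (flip q) b t; try by split.
move: h1 h2 h3 h4; rewrite !rauzy_flip /= => h1 h2 h3 h4.
by exists t', b'.
Qed.

Lemma reach_rows2 p p' q (g : A -> A) t b : reach p p' ->
  rows p t b -> rows q (map g t) (map g b) ->
  exists2 q', reach q q' & exists t' b', rows p' t' b' /\ rows q' (map g t') (map g b').
Proof.
move=> r h h'; elim: r => [|r e _ [q' rq [t' [b' [h1 h2]]]]].
  by exists q; [exact: reach_refl|exists t, b].
by exists (rauzy e q'); [exact: reach_step|exact: rows_rauzy2 h1 h2].
Qed.

Lemma nl_class_rows p q (g : A -> A) t b s :
  rows p t b -> rows q (map g t) (map g b) -> nl_class p s -> nl_class q s.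
Proof.
move=> h h' [p' [r <-]]; have [q' rq [t' [b' [h1 h2]]]] := reach_rows2 r h h'.
by exists q'; split=> //; rewrite (perm_word_rows h1 h2).
Qed.

Definition std_rows p s := exists a z W,
  rows p (a :: rcons W z) (z :: rcons (brev s W) a) /\ size W = sumn s.

(** Block sizes determine the rows up to the names of the letters; [g] is the renaming. *)
Lemma nl_class_std p q s w : std_rows p s -> std_rows q s -> nl_class p w -> nl_class q w.
Proof.
move=> [a [z [W [h sW]]]] [a' [z' [W' [h' sW']]]].
set t := a :: rcons W z; pose g x := nth a (a' :: rcons W' z') (index x t).
have gt : map g t = a' :: rcons W' z'.
  have u : uniq t by case: h => e _; apply: (@map_uniq _ _ p.1); rewrite e iota_uniq.
  have st : size t = size (a' :: rcons W' z') by rewrite /= !size_rcons sW sW'.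
  apply: (@eq_from_nth _ a); rewrite size_map // => i ib.
  by rewrite (nth_map a) // /g index_uniq.
have [ga gW] : g a = a' /\ map g (rcons W z) = rcons W' z' by case: gt.
have [eW ez] : map g W = W' /\ g z = z' by move: gW; rewrite map_rcons => /rcons_inj[].
apply: (@nl_class_rows _ _ g); first exact: h.
by rewrite gt /= map_rcons map_brev ga eW ez.
Qed.

(** Switches lead from [p] to a pair with the block sizes of [q], which is [q] up to renaming. This
    gives one inclusion; the other comes from [beq_sym]. *)
Lemma nl_class_beq p q s s' w : beq s s' -> std_rows p s -> std_rows q s' ->
  nl_class q w -> nl_class p w.
Proof.
move=> [_ hb] [a [z [W [h sW]]]] hq nq.
have [W' [sW' hsw]] := hb _ W sW; have [p' [r h']] := reach_sw hsw h.
have [p'' [r' e]] : nl_class p' w.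
  by apply: nl_class_std hq _ nq; exists a, z, W'.
by exists p''; split=> //; exact: reach_trans r r'.
Qed.

End Rows.

(** * Piece-wise order reversing pairs *)

(** The reversal condition of [por_with] in terms of sizes instead of cut points; [g] sends upper
    positions to lower ones. *)
Fixpoint blocked (g : nat -> nat) (lo : nat) (sz : seq nat) : Prop :=
  if sz is k :: s then
    [/\ 0 < k, forall j, lo <= j < lo + k -> g j + j = lo + (lo + k) - 1 & blocked g (lo + k) s]
  else True.

Lemma blocked_pos g lo s : blocked g lo s -> all (leq 1) s.
Proof. by elim: s lo => //= k s IH lo [-> _ /IH]. Qed.

Lemma blocked_brev g lo s : blocked g lo s ->
  map g (brev s (iota lo (sumn s))) = iota lo (sumn s).
Proof.
elim: s lo => [|k s IH] lo //= [k0 h /IH e].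
rewrite iotaD take_size_cat ?size_iota // drop_size_cat ?size_iota // map_cat e; congr (_ ++ _).
apply: (@eq_from_nth _ 0); rewrite size_map size_rev ?size_iota // => i ib.
rewrite (nth_map 0) ?size_rev ?size_iota // nth_rev ?size_iota // !nth_iota //; last by lia.
by have := h (lo + (k - i.+1)); lia.
Qed.

Lemma block_sizes_cons lo hi ks :
  block_sizes [:: lo, hi & ks] = (hi - lo) :: block_sizes (hi :: ks).
Proof. by rewrite /block_sizes /= (iotaDl 1 0) -map_comp. Qed.

Lemma path_ltn_last x s : path ltn x s -> x <= last x s.
Proof. by elim: s x => //= y s IH x /andP[xy /IH]; apply: leq_trans; exact: ltnW. Qed.

Lemma blocked_sizes g n lo ks : path ltn lo ks -> last lo ks = n ->
  (forall i, i.+1 < size (lo :: ks) -> forall j,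
     nth 0 (lo :: ks) i <= j < nth 0 (lo :: ks) i.+1 -> j < n ->
     g j + j = nth 0 (lo :: ks) i + nth 0 (lo :: ks) i.+1 - 1) ->
  blocked g lo (block_sizes (lo :: ks)) /\ lo + sumn (block_sizes (lo :: ks)) = n.
Proof.
elim: ks lo => [|hi ks IH] lo; first by move=> _ /= ->; rewrite addn0.
rewrite block_sizes_cons => /andP[lh ph] la h.
have [|b e] := IH hi ph la; first by move=> i; apply: (h i.+1).
have hn : hi <= n by rewrite -la; exact: path_ltn_last ph.
have lh' : lo + (hi - lo) = hi by rewrite subnKC // ltnW.
split; last by rewrite /= addnA lh'.
rewrite /= lh'; split=> //; first by rewrite subn_gt0.
move=> j jb; apply: (h 0) => //; case/andP: jb => _ jb; exact: leq_trans jb hn.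
Qed.

Section Positions.
Variables (A : finType) (p : pair A) (d : A).
Hypothesis pair_p : is_pair p.

Definition at_pos k := pinvd d p.1 k.
Definition bot k := p.2 (at_pos k).

Lemma at_posK x : at_pos (p.1 x) = x.
Proof. by rewrite /at_pos /pinvd pinv_inj //; case: pair_p => -[]. Qed.

Lemma pos_atK k : 1 <= k <= #|A| -> p.1 (at_pos k) = k.
Proof. by move=> kb; case: pair_p => -[_ [_ /(_ k kb)[x <-]]] _; rewrite at_posK. Qed.

Lemma pinv_at k : 1 <= k <= #|A| -> pinv p.1 k = Some (at_pos k).
Proof. by move=> kb; rewrite -{1}(pos_atK kb) pinv_inj //; case: pair_p => -[]. Qed.

Lemma pinv_bot k : pinv p.2 (bot k) = Some (at_pos k).
Proof. by rewrite pinv_inj //; case: pair_p => _ []. Qed.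

Lemma por_blocked ks : 2 <= #|A| -> por_with ks p ->
  [/\ blocked bot 2 (block_sizes ks), 2 + sumn (block_sizes ks) = #|A|,
      bot 1 = #|A| & bot #|A| = 1].
Proof.
move=> n2 [[st1 st2] [ks0 hd la so hb]].
have b1 : bot 1 = #|A|.
  move: st1; rewrite pinv_at ?(ltnW n2) //.
  by rewrite /pinv; case: pickP => // x /eqP <- [] /esym e; rewrite /bot -e.
have b2 : bot #|A| = 1.
  move: st2; rewrite pinv_at ?leqnn ?(ltnW n2) //.
  by rewrite /pinv; case: pickP => // x /eqP <- [] /esym e; rewrite /bot -e.
case: ks ks0 hd la so hb => [//|lo ks] _ /= -> la so hb.
have j2 i : i.+1 < size (2 :: ks) -> 2 <= nth 0 (2 :: ks) i.
  move=> ib; have sl : sorted leq (2 :: ks).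
    by apply: (@sub_path _ ltn leq) so => x y; apply: ltnW.
  by apply: (sorted_leq_nth leq_trans leqnn 0 sl 0 i); rewrite ?inE // ltnW.
have [|bl e] := @blocked_sizes bot #|A| 2 ks so la; last by split.
move=> i ib j jb jn; have [_ h] := hb i ib.
have jA : 1 <= j <= #|A|.
  by case/andP: (jb) => jb' _; rewrite (ltnW jn) andbT; exact: leq_trans (ltnW (j2 i ib)) jb'.
by have := h (at_pos j); rewrite pos_atK // addnC; apply.
Qed.

Lemma std_rows_blocked s : 2 <= #|A| -> blocked bot 2 s -> 2 + sumn s = #|A| ->
  bot 1 = #|A| -> bot #|A| = 1 -> std_rows p s.
Proof.
move=> n2 bl sn b1 bn; exists (at_pos 1), (at_pos #|A|), (map at_pos (iota 2 (sumn s))).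
have e1 : iota 1 #|A| = 1 :: rcons (iota 2 (sumn s)) #|A|.
  by rewrite -sn -[LHS]/(1 :: iota 2 (1 + sumn s)) addnC iotaD cats1.
split; last by rewrite size_map size_iota.
split.
  rewrite -map_rcons -(map_cons at_pos 1) -e1 -map_comp.
  by rewrite -[RHS]map_id; apply/eq_in_map => k; rewrite mem_iota add1n ltnS => /pos_atK.
rewrite -map_brev /= map_rcons -/(bot _) -/(bot 1) -map_comp.
by rewrite -[map _ (brev _ _)]/(map bot _) (blocked_brev bl) b1 bn e1.
Qed.

(** * The maps [calS] and [calY] on positions *)

Hypothesis n2 : 2 <= #|A|.
Hypothesis bot1 : bot 1 = #|A|.
Hypothesis botn : bot #|A| = 1.

Let n1 : 1 <= #|A|. Proof. exact: ltnW. Qed.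

Lemma pinvd_at x k : 1 <= k <= #|A| -> pinvd x p.1 k = at_pos k.
Proof. by move=> kb; rewrite /pinvd pinv_at. Qed.

Lemma calS_end k : bot k = 1 -> calS p (at_pos k) = at_pos 1.
Proof. by rewrite /bot /calS => ->; rewrite eqxx pinvd_at // n1. Qed.

(* [plo] is the start of the block before the one starting at [lo]; the
   leftmost letter counts as a block of its own. *)
Definition prev_start plo lo :=
  lo = 2 /\ plo = 1 \/ [/\ 2 < lo, 1 <= plo < #|A| & (bot plo).+1 = lo].

(** For [lo > 2] the letter just before [lo] in the lower row has upper position [plo], and [calS]
    goes one further. For [lo = 2] that letter is the last upper one, and the exceptional clause of
    [calS] uses the last lower letter instead, at upper position 1. *)
Lemma calS_back k plo lo : prev_start plo lo -> bot k = lo ->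
  calS p (at_pos k) = at_pos plo.+1.
Proof.
rewrite /bot /calS => -[[-> ->] ->|[l2 /andP[p1 pn] bl] ->].
  rewrite /= pinvd_at ?n1 ?leqnn // -/(bot _) botn eqxx.
  by rewrite {2}/pinvd -bot1 pinv_bot /= pos_atK ?n1 // pinvd_at.
rewrite ifF; last by apply/eqP => e; rewrite e in l2.
rewrite pinvd_at ?n1 ?leqnn // -/(bot _) botn ifF; last by apply/eqP => e; rewrite e in l2.
rewrite -bl /= {2}/pinvd pinv_bot /= pos_atK ?p1 ?(ltnW pn) // pinvd_at //.
Qed.

Definition ynext : rel nat := fun i j => calY p (at_pos i) == at_pos j.

Lemma calY_S k : bot k != 1 -> calY p (at_pos k) = calS p (at_pos k).
Proof. by rewrite /calY -/(bot k) => /negbTE->. Qed.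

Lemma ynext_back k plo lo : prev_start plo lo -> 2 <= lo -> bot k = lo -> ynext k plo.+1.
Proof.
move=> pl l2 bk; rewrite /ynext calY_S ?(calS_back pl bk) //.
by rewrite bk; apply/eqP => e; rewrite e in l2.
Qed.

Lemma ynext_end plo : prev_start plo #|A| -> ynext #|A| plo.+1.
Proof.
move=> pl; rewrite /ynext /calY -/(bot _) botn /= (calS_end botn).
by rewrite (calS_back pl bot1).
Qed.

Lemma ynext_step lo k j : 2 <= lo -> lo + k <= #|A| ->
  (forall i, lo <= i < lo + k -> bot i + i = lo + (lo + k) - 1) ->
  lo <= j -> j.+1 < lo + k -> ynext j j.+2.
Proof.
move=> l2 kn h j1 j2; have hj := h j; have hj' := h j.+1.
(* Inside a block the letter at [j.+1] precedes the one at [j] in the lower row, so it takes the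
   role of [plo]. *)
apply: (@ynext_back _ _ (bot j)) => //; last by lia.
by right; split; lia.
Qed.

(** The last letter of a block goes to the second letter of the preceding block, the head of [w]. In
    an odd block it lies on the path of the first letter, closing a cycle; in an even block on that
    of the second letter, which continues through [w]. The default in [head lo w] covers a preceding
    1-block, where [w] is empty. *)
Lemma yseq_cycles s lo w plo : blocked bot lo s -> lo + sumn s = #|A| -> 2 <= lo ->
  prev_start plo lo -> sorted ynext (rcons w lo) -> head lo w = plo.+1 ->
  all (cycle ynext) (yseq lo s w).
Proof.
elim: s lo w plo => [|k s IH] lo w plo /=.
  rewrite addn0 => _ -> _ pl sw hw; rewrite andbT.
  apply: (@cycle_link _ _ 0) => //; rewrite last_rcons headI /= hw.
  exact: ynext_end.
move=> [k0 hb bl] sn l2 pl sw hw.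
have kn : lo + k <= #|A| by rewrite -sn leq_add2l leq_addr.
have step := ynext_step l2 kn hb.
have back : ynext (lo + k).-1 plo.+1.
  by apply: ynext_back pl l2 _; have := hb (lo + k).-1; lia.
have pl' : prev_start lo (lo + k).
  right; have := hb lo; split; lia.
have sn' : lo + k + sumn s = #|A| by rewrite -addnA.
have l2' : 2 <= lo + k by apply: leq_trans (leq_addr _ _).
case: ifP => ko.
  have [h ek] : exists h, k = h.*2.+1 by exists k./2; lia.
  have so : sorted ynext (odds lo k) by rewrite ek; apply: sorted_odds => j j1 j2; apply: step; lia.
  apply/andP; split.
    apply: (@cycle_link _ _ 0); first by move: so; rewrite ek oddsS; apply: sorted_glue.
    have -> : last 0 (w ++ odds lo k) = (lo + k).-1.
      by rewrite ek odds_rcons -rcons_cat last_rcons addnS.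
    by rewrite ek oddsS; move: back; rewrite -hw ek; case: (w).
  apply: (IH _ _ lo) => //; rewrite ek.
    rewrite /= addnS -addSn -odds_rcons; apply: sorted_odds => j j1 j2; apply: step; lia.
  by case: (h) => [|h'] /=; rewrite ?addn1.
have [h ek] : exists h, k = h.+1.*2 by exists (k./2).-1; lia.
have ek1 : k.-1 = h.*2.+1 by rewrite ek.
apply: (IH _ _ lo) => //; last by rewrite ek1 oddsS.
have st : sorted ynext (w ++ rcons (odds lo k) (lo + k)).
  rewrite ek -odds_rcons oddsS; apply: sorted_glue => //.
  by rewrite -oddsS; apply: sorted_odds => j j1 j2; apply: step; lia.
have se : sorted ynext (odds lo.+1 k.-1).
  by rewrite ek1; apply: sorted_odds => j j1 j2; apply: step; lia.
have le : last 0 (odds lo.+1 k.-1) = (lo + k).-1.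
  by rewrite ek1 odds_rcons last_rcons ek; lia.
have eo : odds lo k = lo :: odds lo.+2 k.-2 by rewrite ek doubleS.
rewrite !rcons_cat; move: st hw; rewrite eo.
case: (w) => [|x w'] /= st hw; apply: (@sorted_link _ _ 0) => // _; by rewrite le; move: back; rewrite -hw.
Qed.

Lemma bot_inj i j : 1 <= i <= #|A| -> 1 <= j <= #|A| -> bot i = bot j -> i = j.
Proof.
move=> ib jb e; have := pinv_bot i; rewrite e pinv_bot => -[e'].
by rewrite -(pos_atK ib) -(pos_atK jb) e'.
Qed.

Lemma yseq_flatten s : all (leq 1) s -> 2 + sumn s = #|A| ->
  perm_eq (flatten (yseq 2 s [::])) (iota 2 #|A|.-1).
Proof. by move=> hs <-; apply: yseq_perm. Qed.

Lemma yseq_start s : blocked bot 2 s -> 2 + sumn s = #|A| ->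
  all (cycle ynext) (yseq 2 s [::]).
Proof. by move=> bl sn; apply: (@yseq_cycles _ _ _ 1) => //; left. Qed.

(** The cycles in [yseq] partition the positions from 2 on, that is, all letters but the leftmost
    upper one. *)
Lemma calP_cyclens s : blocked bot 2 s -> 2 + sumn s = #|A| ->
  perm_eq (calP p) (cyclens s 0).
Proof.
move=> bl sn; rewrite /calP pinv_at ?n1 // -[0]/(size (Nil nat)) -(size_yseq 2).
have := @orders_cycles A (calY p) (fun x => x != at_pos 1) (map (map at_pos) (yseq 2 s [::])).
rewrite -map_comp (eq_map (g := size)); last by move=> c; rewrite /= size_map.
apply.
- rewrite all_map; apply: sub_all (yseq_start bl sn) => c /=.
  by rewrite cycle_map.
- rewrite all_map; have := cyclens_pos s 0; rewrite -[0]/(size (Nil nat)) -(size_yseq 2) all_map.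
  by apply: sub_all => c /=; rewrite size_map.
rewrite -map_flatten.
apply: perm_trans (perm_map _ (yseq_flatten (blocked_pos bl) sn)) _.
apply: uniq_perm.
- rewrite map_inj_in_uniq ?iota_uniq // => i j; rewrite !mem_iota => ib jb e.
  by rewrite -(@pos_atK i) ?e ?pos_atK //; lia.
- by rewrite filter_uniq // enum_uniq.
move=> x; rewrite mem_filter mem_enum andbT; apply/mapP/idP => [[i]|/eqP x1].
  rewrite mem_iota => ib ->; apply/eqP => e; have := congr1 p.1 e; rewrite !pos_atK ?n1 //; lia.
exists (p.1 x); last by rewrite at_posK.
case: pair_p => -[_ [/(_ x) xb _]] _; rewrite mem_iota.
have : p.1 x != 1 by apply/eqP => e; apply: x1; rewrite -e at_posK.
by lia.
Qed.

(** Inserting the first upper letter after the last one turns the last cycle of [calY] into the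
    cycle of [calS] through that first letter, one longer. *)
Lemma calM_cyclens s : blocked bot 2 s -> 2 + sumn s = #|A| ->
  calM p = (last 0 (cyclens s 0)).+1.
Proof.
move=> bl sn; rewrite /calM pinv_at ?n1 // -(size_yseq 2 s [::]).
have [w' e] := last_yseq 2 s [::]; rewrite sn in e.
have cin : rcons w' #|A| \in yseq 2 s [::].
  by rewrite -e; case: yseq (@yseq_neq0 2 s [::]) => // c cs _; rewrite /= mem_last.
rewrite (last_map size _ [::]) e.
have hc := allP (yseq_start bl sn) _ cin.
have pe := yseq_flatten (blocked_pos bl) sn.
have cb i : i \in rcons w' #|A| -> 2 <= i <= #|A|.
  move=> ic; have : i \in iota 2 #|A|.-1.
    by rewrite -(perm_mem pe); apply/flattenP; exists (rcons w' #|A|).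
  by rewrite mem_iota; lia.
have uc : uniq (rcons w' #|A|).
  have : uniq (flatten (yseq 2 s [::])) by rewrite (perm_uniq pe) iota_uniq.
  move: cin; case/splitPr => l1 l2; rewrite flatten_cat /= !cat_uniq.
  by case/and3P=> _ _ /and3P[].
have inj : {in 1 :: rcons w' #|A| &, injective at_pos}.
  have ib i : i \in 1 :: rcons w' #|A| -> 1 <= i <= #|A|.
    by rewrite inE => /orP[/eqP->|/cb]; lia.
  by move=> i j /ib hi /ib hj e'; rewrite -(pos_atK hi) -(pos_atK hj) e'.
set c := map at_pos (1 :: rcons w' #|A|).
have -> : (size (rcons w' #|A|)).+1 = size c by rewrite size_map.
apply: order_cycle; last by rewrite /c /= mem_head.
  rewrite /c cycle_map.
  case e' : (rcons w' #|A|) hc cb uc => [|x t]; first by case: (w') e'.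
  have [eb el] : belast x t = w' /\ last x t = #|A|.
    by move: e'; rewrite lastI => /rcons_inj[].
  move=> /= hc cb uc; move: hc; rewrite !rcons_path el => /andP[hp hx].
  rewrite /= (calS_end botn) eqxx andbT; apply/andP; split.
    by move: hx; rewrite /ynext /calY -/(bot _) botn /= (calS_end botn).
  (* Only the last upper letter has lower position 1, so [calY] and [calS] agree along [w']. *)
  apply: path_sub_in hp _ => i j; rewrite eb => iw; rewrite /ynext calY_S //.
  have ii : i \in x :: t by rewrite -e' mem_rcons inE iw orbT.
  apply/eqP => bi; have := cb i ii => ib.
  have ei : i = #|A| by apply: bot_inj; rewrite ?n1 ?leqnn ?bi ?botn //; case/andP: ib => /ltnW->.
  by move: uc; rewrite -[_ && _]/(uniq (x :: t)) -e' rcons_uniq -ei iw.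
rewrite /c map_inj_in_uniq //= uc andbT.
by apply/negP => /cb; lia.
Qed.

End Positions.

(** * Comparison of the two non-labeled classes *)

Theorem theorem4p5 (A : finType) (p q : pair A) :
  2 <= #|A| ->
  is_pair p -> is_pair q ->
  irreducible p -> irreducible q ->
  por p -> por q ->
  same_type p q ->
  perm_eq (calP p) (calP q) ->
  calM p = calM q ->
  forall s : seq nat, nl_class p s <-> nl_class q s.
Proof.
move=> n2 pp pq _ _ _ _ [t [_ [ks [hp tp]] [ks' [hq tq]]]] eP eM w.
have [d _] : exists d : A, d \in A by apply/card_gt0P; exact: ltnW.
have [b s1 b1 bn] := por_blocked d pp n2 hp.
have [b' s1' b1' bn'] := por_blocked d pq n2 hq.
have st := std_rows_blocked pp n2 b s1 b1 bn.
have st' := std_rows_blocked pq n2 b' s1' b1' bn'.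
have be : beq (block_sizes ks) (block_sizes ks').
  apply: beq_type tp tq _ _; rewrite ?(blocked_pos b) ?(blocked_pos b') //.
  - by apply: (@addnI 2); rewrite s1 s1'.
  - rewrite -(permPl (calP_cyclens pp n2 b1 bn b s1)).
    by apply: perm_trans eP _; exact: (calP_cyclens pq n2 b1' bn' b' s1').
  by move: eM; rewrite (calM_cyclens pp n2 b1 bn b s1) (calM_cyclens pq n2 b1' bn' b' s1') => -[].
split; first exact: nl_class_beq (beq_sym be) st' st.
exact: nl_class_beq be st st'.
Qed.
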